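(* Let $k\ge 0$ be an integer, and let $N=p^k$, $N=3p^k$ or $N=4p^k$ with $p$ prime, or $N=6p^k$ with $p\neq 3$ prime. Then the cyclotomic polynomial $\Phi_N(t)$ does not divide (in $\mathbb{Z}[t,t^{-1}]$) the Jones polynomial $V_K(t)$ of any knot $K\subset S^3$.
   Context: $\Phi_N$ is the $N$-th cyclotomic polynomial. The Jones polynomial of a knot $K$ is $V_K(t)\in\mathbb{Z}[t,t^{-1}]$, normalized to be $1$ on the unknot. *)

(* Defs.v *)
From HB Require Import structures.
From mathcomp Require Export all_boot all_order all_algebra all_field.

Set Implicit Arguments.
Unset Strict Implicit.
Unset Printing Implicit Defensive.

Import Order.TTheory GRing.Theory Num.Theory.
Local Open Scope ring_scope.

(* Oriented link diagrams on the sphere, as combinatorial maps.  A dart (c, s)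
   is one of the four half-edges at the crossing c.  The slots s : 'Z_4 are
   numbered counterclockwise: the strand passing under enters at slot 0 and
   leaves at slot 2, so that the strand passing over joins slots 1 and 3.  It
   runs from 3 to 1 at a positive crossing and from 1 to 3 at a negative one.
   [glue] sends a half-edge to the other half of the same edge, and [circles] is
   the number of components without crossings; in particular a diagram with
   no crossing and [circles] = 1 is the round circle. *)
Record diagram := Diagram {
  crossing :> finType;
  positive : pred crossing;
  glue : crossing * 'Z_4 -> crossing * 'Z_4;
  circles : nat
}.

Section Diagrams.
Variable D : diagram.

Definition dart : finType := (D * 'Z_4)%type.

Definition outgoing (d : dart) : bool :=
  (d.2 == 2) || (d.2 == (if positive d.1 then 1 else 3)).

Definition oriented : Prop :=
  involutive (@glue D) /\ forall d : dart, outgoing (glue d) = ~~ outgoing d.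

Definition face_step (d : dart) : dart :=
  let d' := glue d in (d'.1, d'.2 + 1).

Definition connected_parts : nat :=
  n_comp [rel d d' : dart | (d' == glue d) || (d'.1 == d.1)] predT.

(* Genus zero: V - E + F is twice the number of connected parts, where
   V = #|D| and E = 2 #|D|. *)
Definition planar : Prop :=
  fcard face_step predT = (#|D| + 2 * connected_parts)%N.

(* The number of closed curves obtained by following the edges and, at each
   crossing c, joining the slot s to the slot [link c s]. *)
Definition curves (link : D -> 'Z_4 -> 'Z_4) : nat :=
  (circles D + n_comp [rel d d' : dart |
     (d' == glue d) || (d' == (d.1, link d.1 d.2))] predT)%N.

Definition components : nat := curves (fun _ s => s + 2).

(* The A-smoothing joins the two regions swept out when the over strand is
   turned counterclockwise: it links slots 0-1 and 2-3.  The B-smoothing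
   links slots 1-2 and 3-0. *)
Definition smoothing (S : {set D}) (c : D) (s : 'Z_4) : 'Z_4 :=
  if c \in S then 1 - s else 3 - s.

Definition writhe : int := \sum_(c : D) (if positive c then 1 else - 1).

(* S ranges over the states: the crossings in S get the A-smoothing, the
   others the B-smoothing.  The round circle has bracket 1. *)
Definition kauffman_bracket (R : comUnitRingType) (A : R) : R :=
  \sum_(S : {set D})
    A ^ (#|S|%:Z - #|~: S|%:Z)
    * (- A ^+ 2 - A ^- 2) ^+ (curves (smoothing S)).-1.

End Diagrams.

(* Knots are taken through their diagrams.  By Reidemeister's theorem the
   Jones polynomial of a knot can be computed from any of its diagrams. *)
Record knot_diagram := KnotDiagram {
  knot_diag :> diagram;
  knot_oriented : oriented knot_diag;
  knot_planar : planar knot_diag;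
  knot_connected : components knot_diag = 1%N
}.

(* The state sum naturally lives in Z[t^(1/4), t^(-1/4)], with
   A = t^(-1/4).  We realize it, and its subring Z[t, t^-1], inside the
   fraction field of Z[t^(1/4)]. *)
Definition quarter_field : fieldType := {fraction {poly int}}.

Definition t4 : quarter_field := tofrac ('X : {poly int}).

Definition tvar : quarter_field := t4 ^+ 4.

Definition at_t (P : {poly int}) : quarter_field := (map_poly intr P).[tvar].

Definition is_laurent (f : quarter_field) : Prop :=
  exists (P : {poly int}) (m : nat), f = at_t P / tvar ^+ m.

Definition laurent_dvd (f g : quarter_field) : Prop :=
  exists2 h : quarter_field, is_laurent h & g = h * f.

Definition jones (K : knot_diagram) : quarter_field :=
  let A := t4^-1 in (- A ^+ 3) ^ (- writhe K) * kauffman_bracket K A.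

(* Main.v *)
From HB Require Import structures.
From mathcomp Require Import all_fingroup.
From mathcomp Require Import ring.
Require Import Defs.

Set Implicit Arguments.
Unset Strict Implicit.
Unset Printing Implicit Defensive.

Import Order.TTheory GRing.Theory Num.Theory.
Local Open Scope ring_scope.

(** Write N = m * p ^ k with p not dividing m.  In characteristic p the
    polynomial Phi_N vanishes at every element t of exact order m, so Phi_N
    cannot divide V_K as soon as V_K(t) is nonzero in some field of
    characteristic p.  When p is 2 or 3, the factors p of 3, 4 or 6 are absorbed
    in p ^ k; under the hypotheses on N this leaves m among 1, 3, 4 and 6.  So
    the theorem reduces to the classical evaluations of V_K at roots of unity
    of these orders, or rather to the fact that they stay nonzero modulo p.

    Let delta = - A^2 - A^-2 be the loop value of the Kauffman bracket, where
    t = A^-4; then delta^2 = t + 2 + t^-1 is 4, 1, 2, 3 for m = 1, 3, 4, 6.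

    - m = 3: one can choose A with delta = 1, and the state sum collapses to
      (A + A^-1) ^ n ([bracket_neq0_third]).

    - m = 1: with A^2 = -1 one has delta = 2, so 2 ^ (number of curves) counts
      the two-colourings of the curves of a state.  Exchanging the sums leaves
      a sum over two-colourings of the edges of the diagram in which only the
      colourings that alternate along the knot survive; there are exactly
      two of them and they contribute the same sign ([signed_curve_sum_unit]).

    - m = 4 and m = 6: delta^2 = q is the prime 2 or 3, and the bracket is,
      up to a nonzero factor, the partition function of a spin model with
      values in F_q on the black regions of the checkerboard colouring
      ([bracket_spin_sum]).  The local weight is 1 when the two black corners
      of a crossing carry the same spin and zeta ^ (1 or -1) otherwise,
      with zeta = - t.  For q = 3 the element zeta has order 3 and this is
      zeta ^ (x - y) ^ 2 up to sign of the exponent; for q = 2 it has order 4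
      and the weights form a quadratic form with values in Z/4.  In both cases
      the partition function is a Gauss sum, whose product with the conjugate
      sum is a power of q as soon as the form vanishes on its radical
      ([gauss_sum_neq0]).  This is automatic for q = 3; for q = 2 it uses that
      the diagram has a single component ([radical_F2]).

    The spin model needs the topology of the plane: if a state S has c(S)
    curves, joins the black corners of j(S) crossings and lets q ^ b(S) spin
    assignments be constant on its black regions, then c(S) = 2 b(S) + j(S)
    up to a constant ([curves_smoothing]).  The only input is the Euler
    formula.  It says that there are q ^ (n + 2) functions from the faces to
    F_q, and a count then shows that every cycle on the edges is the
    difference of a face function across each edge ([grad_exact]): the
    sphere has no first homology.  Over F_2 this produces the checkerboard
    colouring; over F_q it shows that functions on the curves of S are the
    same, up to constants, as functions on the regions of S.  The black and
    the white contributions are then related by duality in F_q ^ n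
    ([card_joined_dual]). *)

(** * Counting in finite spaces of functions *)

(* Joins the finite and the additive structures of {ffun T -> W}. *)
HB.instance Definition _ (T : finType) (W : finZmodType) :=
  GRing.Zmodule.on {ffun T -> W}.

Lemma card_fibers (V W : finZmodType) (H : {set V}) (al : V -> W) :
    zmod_closed H -> {morph al : x y / x - y} ->
  #|H| = (#|al @: H| * #|[set x in H | al x == 0%R]|)%N.
Proof.
move=> [H0 HB] alB; pose K := [set x in H | al x == 0].
rewrite -sum1_card (partition_big al (mem (al @: H))) /=; last first.
  by move=> x Hx; apply: imset_f.
rewrite -sum_nat_const; apply: eq_bigr => y /imsetP[x0 Hx0 ->].
rewrite sum1_card.
rewrite -(card_imset (mem K) (f := fun x => x0 - x)); last first.
  by move=> x y' /addrI/oppr_inj.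
apply: eq_card => x; rewrite unfold_in; apply/andP/imsetP => [[Hx /eqP e]|[y1 + ->]].
  exists (x0 - x); last by rewrite opprB addrC subrK.
  by rewrite inE HB //= alB e subrr eqxx.
by rewrite inE => /andP[Hy /eqP e]; rewrite HB // alB e subr0 eqxx.
Qed.

(** An additive subgroup of F_q ^ T has order dividing q ^ #|T|. *)
Lemma card_zmod_closed (T : finType) (q : nat)
    (H : {set {ffun T -> 'F_q}}) :
  prime q -> zmod_closed H -> exists m, #|H| = (q ^ m)%N.
Proof.
move=> q_pr [H0 HB].
have HG : group_set (H : {set (({ffun T -> 'F_q} : Type) : finZmodType)}).
  apply/group_setP; split=> // x y Hx Hy; rewrite FinRing.zmodMgE -[y]opprK.
  by rewrite HB // -sub0r HB.
have := cardSg (subsetT (group HG)).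
rewrite cardsT card_ffun card_Fp // => /(dvdn_pfactor _ _ q_pr)[m _ e].
by exists m.
Qed.

Section Characters.
Variables (q : nat) (L : idomainType) (z : L).
Hypotheses (q_pr : prime q) (z_prim : q.-primitive_root z).

Definition chi (a : 'F_q) : L := z ^+ a.

Lemma chi0 : chi 0 = 1. Proof. by []. Qed.

Lemma chiD : {morph chi : a b / a + b >-> a * b}.
Proof.
move=> a b; rewrite /chi -exprD -[RHS](prim_expr_mod z_prim).
by congr (_ ^+ _); congr (modn _ _); exact: Fp_cast.
Qed.

Lemma chi_eq1 a : (chi a == 1) = (a == 0).
Proof.
rewrite /chi -(prim_order_dvd z_prim) -(inj_eq val_inj) /=.
have lt_a : (a < q)%N by rewrite -[X in (_ < X)%N](Fp_cast q_pr).
apply/idP/eqP => [d|->]; last exact: dvdn0.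
case: (posnP a) => // a_gt0.
by move: (dvdn_leq a_gt0 d); rewrite leqNgt lt_a.
Qed.

Lemma chi_sum (I : finType) (P : pred I) (f : I -> 'F_q) :
  chi (\sum_(i | P i) f i) = \prod_(i | P i) chi (f i).
Proof. by rewrite (big_morph chi chiD chi0). Qed.

(** Orthogonality of characters: translating by an h with lam h <> 0 multiplies
    the sum by chi (lam h) <> 1. *)
Lemma sum_chi (V : finZmodType) (H : {set V}) (lam : V -> 'F_q) :
    zmod_closed H -> {morph lam : x y / x - y} ->
  \sum_(x in H) chi (lam x) = if [forall x in H, lam x == 0] then #|H|%:R else 0.
Proof.
move=> [H0 HB] lamB; case: ifP => [/forall_inP l0|].
  rewrite (eq_bigr (fun=> 1)) ?sumr_const // => x Hx.
  by rewrite (eqP (l0 x Hx)) chi0.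
move=> /negbT; rewrite negb_forall_in => /exists_inP[h Hh nz_h].
apply/eqP; have: (chi (lam h) - 1) * (\sum_(x in H) chi (lam x)) == 0.
  rewrite mulrBl mul1r subr_eq0 mulr_sumr; apply/eqP.
  rewrite [RHS](reindex_inj (subIr (- h))) /=.
  have lam0 : lam 0 = 0 by rewrite -(subrr 0) lamB subrr.
  have HN y : y \in H -> - y \in H by move=> Hy; rewrite -sub0r HB.
  apply: eq_big => [x|x Hx]; rewrite opprK.
    apply/idP/idP => [Hx|Hx]; first by rewrite -[h]opprK HB ?HN.
    by rewrite -(addrK h x) HB.
  by rewrite -chiD -{2}[h]opprK lamB -sub0r lamB lam0 sub0r opprK addrC.
by rewrite mulf_eq0 subr_eq0 chi_eq1 (negPf nz_h).
Qed.

End Characters.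

Definition pairing (q : nat) (I : finType) (g a : {ffun I -> 'F_q}) : 'F_q :=
  \sum_i g i * a i.

Section Pairing.
Variables (q : nat) (I : finType).
Implicit Types g a : {ffun I -> 'F_q}.

Lemma pairingBl a : {morph (@pairing q I)^~ a : g h / g - h}.
Proof.
move=> g h; rewrite /pairing -sumrB; apply: eq_bigr => i _.
by rewrite !ffunE mulrBl.
Qed.

Lemma pairingBr g : {morph pairing g : a b / a - b}.
Proof.
move=> a b; rewrite /pairing -sumrB; apply: eq_bigr => i _.
by rewrite !ffunE mulrBr.
Qed.
End Pairing.

Definition annihilator (q : nat) (I : finType) (A : {set {ffun I -> 'F_q}}) :
    {set {ffun I -> 'F_q}} :=
  [set g | [forall a in A, pairing g a == 0]].

Definition supported (q : nat) (I : finType) (J : {set I}) :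
    {set {ffun I -> 'F_q}} :=
  [set g : {ffun I -> 'F_q} | [forall i, (i \notin J) ==> (g i == 0)]].

Lemma supported_closed (q : nat) (I : finType) (J : {set I}) :
  zmod_closed (supported q J).
Proof.
split=> [|g h]; first by rewrite inE; apply/forallP => i; rewrite ffunE eqxx implybT.
rewrite !inE => /forallP Hg /forallP Hh; apply/forallP => i; apply/implyP => ni.
by rewrite !ffunE (eqP (implyP (Hg i) ni)) (eqP (implyP (Hh i) ni)) subrr.
Qed.

Lemma card_supported (q : nat) (I : finType) (J : {set I}) :
  prime q -> #|supported q J| = (q ^ #|J|)%N.
Proof.
move=> q_pr; rewrite -[X in (X ^ _)%N](card_Fp q_pr) -(card_pffun_on (0 : 'F_q) (mem J) (mem 'F_q)).
apply: eq_card => g; rewrite inE.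
apply/forallP/pffun_onP => [Hg|[Hg _] i].
  split=> // ; apply/subsetP => i; rewrite !inE; apply: contraR => ni.
  exact: (implyP (Hg i) ni).
apply/implyP; apply: contraR => nz; exact: (subsetP Hg).
Qed.

(** Double count of the sum of chi (<g, al x>) over x in H and g supported on J:
    summing first over g keeps the x whose image vanishes on J, summing first
    over x keeps the g orthogonal to al H.  The sum is taken in the algebraic
    numbers, where it determines the two counts. *)
Lemma card_annihilator (V : finZmodType) (q : nat) (I : finType)
    (H : {set V}) (al : V -> {ffun I -> 'F_q}) (J : {set I}) :
    prime q -> zmod_closed H -> {morph al : x y / x - y} ->
  (#|annihilator (al @: H) :&: supported q J| * #|H|
    = q ^ #|J| * #|[set x in H | [forall i in J, al x i == 0%R]]|)%N.
Proof.
move=> q_pr clH alB.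
have [z zP] := C_prim_root_exists (prime_gt0 q_pr).
pose S := \sum_(x in H) \sum_(g in supported q J) chi z (pairing g (al x)).
have S1 : S = (q ^ #|J| * #|[set x in H | [forall i in J, al x i == 0%R]]|)%:R.
  rewrite natrM -(card_supported J q_pr) mulr_natr -sumr_const.
  rewrite [RHS](eq_bigl (fun x => (x \in H) && [forall i in J, al x i == 0])); last first.
    by move=> x; rewrite inE.
  rewrite big_mkcondr /=; apply: eq_bigr => x Hx.
  rewrite (sum_chi q_pr zP (supported_closed _ _) (lam := (@pairing q I)^~ (al x))).
    congr (if _ then _ else _); apply/forall_inP/forall_inP => [h i Ji|h g].
      pose d : {ffun I -> 'F_q} := [ffun j => (j == i)%:R].
      have /h : d \in supported q J.
        rewrite inE; apply/forallP => j; apply/implyP; rewrite ffunE.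
        by case: (eqVneq j i) => [->|//]; rewrite Ji.
      rewrite /pairing (bigD1 i) //= ffunE eqxx mul1r big1 ?addr0 // => j.
      by rewrite ffunE => /negPf->; rewrite mul0r.
    rewrite inE => /forallP Hg; rewrite /pairing big1 // => i _.
    case: (boolP (i \in J)) => [/h/eqP->|ni]; first by rewrite mulr0.
    by rewrite (eqP (implyP (Hg i) ni)) mul0r.
  exact: pairingBl.
have S2 : S = (#|annihilator (al @: H) :&: supported q J| * #|H|)%:R.
  rewrite /S exchange_big natrM mulr_natl -sumr_const /=.
  rewrite [RHS](eq_bigl (fun g => (g \in supported q J) && (g \in annihilator (al @: H)))); last first.
    by move=> g; rewrite inE andbC.
  rewrite big_mkcondr /=; apply: eq_bigr => g Hg.
  rewrite (sum_chi q_pr zP clH (lam := fun x => pairing g (al x))); last first.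
    by move=> x y; rewrite alB pairingBr.
  congr (if _ then _ else _); rewrite inE.
  apply/forall_inP/forall_inP => [h a /imsetP[x Hx ->]|h x Hx]; first exact: h.
  by apply/h/imset_f.
by apply/eqP; rewrite -(eqr_nat algC) -S1 -S2.
Qed.

(** * Gauss sums of quadratic functions *)
Section GaussSum.
Variables (q : nat) (L : fieldType) (z : L) (T I : finType).
Hypotheses (q_pr : prime q) (z_prim : q.-primitive_root z) (q_neq0 : q%:R != 0 :> L).
Variables (H : {set {ffun T -> 'F_q}}) (al : {ffun T -> 'F_q} -> {ffun I -> 'F_q}).
Hypotheses (clH : zmod_closed H) (alB : {morph al : x y / x - y}).
Variables (eta : I -> 'F_q) (phi : I -> 'F_q -> L).
Hypothesis phi_neq0 : forall i a, phi i a != 0.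
Hypothesis phiD : forall i a b,
  phi i (a + b) = phi i a * phi i b * chi z (eta i * a * b).

Definition polar (u x : {ffun T -> 'F_q}) : 'F_q := \sum_i eta i * al u i * al x i.
Definition radical := [set u in H | [forall x in H, polar u x == 0]].

Hypothesis phi_radical : forall u, u \in radical -> \prod_i phi i (al u i) = 1.

(** The product with the conjugate sum is a double sum; substituting x = u + y
    makes the y-sum a character sum, which kills every u outside the radical.
    There remains #|radical| * #|H|, a power of q. *)
Lemma gauss_sum_neq0 : \sum_(x in H) \prod_i phi i (al x i) != 0.
Proof.
have [H0 HB] := clH.
have HN y : y \in H -> - y \in H by move=> Hy; rewrite -sub0r HB.
have al0 : al 0 = 0 by rewrite -(subrr 0) alB subrr.
have alD x y : al (x + y) = al x + al y.
  by rewrite -{1}[y]opprK alB -[- y]sub0r alB al0 sub0r opprK.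
have polarBr u : {morph polar u : x y / x - y}.
  move=> x y; rewrite /polar -sumrB; apply: eq_bigr => i _.
  by rewrite alB !ffunE mulrBr.
have polarBl x : {morph polar^~ x : u y / u - y}.
  move=> u y; rewrite /polar -sumrB; apply: eq_bigr => i _.
  by rewrite alB !ffunE mulrBr mulrBl.
have clR : zmod_closed radical.
  split=> [|u v].
    rewrite inE H0; apply/forall_inP => x Hx; rewrite /polar big1 // => i _.
    by rewrite al0 ffunE mulr0 mul0r.
  rewrite !inE => /andP[Hu /forall_inP ru] /andP[Hv /forall_inP rv].
  rewrite HB //=; apply/forall_inP => x Hx.
  by rewrite polarBl (eqP (ru x Hx)) (eqP (rv x Hx)) subrr.
have [m cH] := card_zmod_closed q_pr clH.
have [r cR] := card_zmod_closed q_pr clR.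
pose S' := \sum_(y in H) \prod_i (phi i (al y i))^-1.
suff: (\sum_(x in H) \prod_i phi i (al x i)) * S' != 0.
  by rewrite mulf_eq0 negb_or => /andP[].
have -> : (\sum_(x in H) \prod_i phi i (al x i)) * S' = (#|radical| * #|H|)%:R.
  rewrite /S' mulr_sumr (eq_bigr (fun y => \sum_(u in H)
    (\prod_i phi i (al u i)) * chi z (polar u y))); last first.
    move=> y Hy; rewrite mulr_suml (reindex_inj (addIr y)) /=.
    apply: eq_big => [u|u _].
      apply/idP/idP => [h|h]; first by rewrite -(addrK y u) HB.
      by rewrite -[y]opprK HB ?HN.
    rewrite (chi_sum q_pr z_prim) -!big_split; apply: eq_bigr => i _ /=.
    by rewrite alD ffunE phiD mulrAC mulfK.
  rewrite exchange_big natrM -sumr_const mulr_suml.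
  rewrite [RHS](eq_bigl (fun u => (u \in H) && [forall x in H, polar u x == 0])); last first.
    by move=> u; rewrite inE.
  rewrite big_mkcondr; apply: eq_bigr => u Hu.
  rewrite -mulr_sumr (sum_chi q_pr z_prim clH (polarBr u)).
  by case: ifP => ru; rewrite ?mulr0 // phi_radical // inE Hu.
by rewrite cH cR -expnD natrX expf_neq0.
Qed.

End GaussSum.

(** * Functions constant on connected components *)
Section ComponentCounting.
Variables (T : finType) (e : rel T).
Hypothesis e_sym : connect_sym e.

Lemma n_comp_connect1 : n_comp e predT = 1%N -> forall x y, connect e x y.
Proof.
move=> n1 x y; rewrite -(root_connect e_sym); move: n1; rewrite /n_comp_mem => /eqP/card1P[r rP].
have hr w : fingraph.root e w = r.
  by apply/eqP; have := rP (fingraph.root e w); rewrite !inE /= (roots_root e_sym).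
by rewrite !hr.
Qed.

Lemma n_comp_gt0 (x : T) : (0 < n_comp e predT)%N.
Proof. by apply/card_gt0P; exists (fingraph.root e x); rewrite inE /= (roots_root e_sym). Qed.

Lemma connect_const (W : Type) (f : T -> W) x y :
  (forall x y, e x y -> f x = f y) -> connect e x y -> f x = f y.
Proof.
move=> fP /connectP[p]; elim: p x => [|x' p IHp] x /= => [_ -> //|/andP[ex ep] ey].
by rewrite (fP _ _ ex); apply: IHp.
Qed.

(** Such a function is determined by its values on the chosen roots of the
    components. *)
Lemma card_const_comp (k : finType) (P : pred {ffun T -> k}) :
    (forall f : {ffun T -> k}, reflect (forall x y, e x y -> f x = f y) (P f)) ->
  #|[set f | P f]| = (#|k| ^ n_comp e predT)%N.
Proof.
move=> PP; rewrite /n_comp_mem.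
pose D := [set x | roots e x]; pose S : finType := {x | x \in D}.
have cD : #|[predI roots e & predT]| = #|S|.
  by rewrite card_sig; apply: eq_card => x; rewrite !inE andbT.
rewrite cD -card_ffun.
have rD x : fingraph.root e x \in D by rewrite inE (roots_root e_sym).
pose ext (g : {ffun S -> k}) : {ffun T -> k} :=
  [ffun x => g (exist _ (fingraph.root e x) (rD x))].
have ext_inj : injective ext.
  move=> g g' /ffunP E; apply/ffunP => -[x Dx]; have := E x; rewrite !ffunE.
  suff -> : exist (fun x => x \in D) (fingraph.root e x) (rD x) = exist _ x Dx by [].
  by apply: val_inj => /=; move: (Dx); rewrite inE => /eqP.
rewrite -(card_imset _ ext_inj); apply: eq_card => f; rewrite inE.
apply/PP/imsetP => [Hf|[g _ -> x y exy]].
  exists [ffun x => f (val x)] => //; apply/ffunP => x; rewrite !ffunE /=.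
  exact: connect_const Hf (connect_root _ _).
rewrite !ffunE; congr (g _); apply: val_inj => /=.
exact/(fingraph.rootP e_sym)/connect1.
Qed.

End ComponentCounting.

(** * Darts and crossings *)
Lemma state_weight (C : finType) (L : fieldType) (A : L) (S : {set C}) : A != 0 ->
  A ^ (#|S|%:Z - #|~: S|%:Z) = \prod_c (if c \in S then A else A^-1).
Proof.
move=> A_neq0; rewrite expfzDr // -exprz_inv -!exprnP -!prodr_const.
rewrite [RHS](bigID (mem S)) /=; congr (_ * _); apply: eq_big => // c; rewrite ?inE //.
  by move=> ->.
by move=> /negPf->.
Qed.

Lemma sub_ffunE (T : finType) (V : zmodType) (f g : {ffun T -> V}) x :
  (f - g) x = f x - g x.
Proof. by rewrite !ffunE. Qed.

Lemma Z4_ind (P : 'Z_4 -> Prop) : P 0 -> P 1 -> P 2 -> P 3 -> forall s, P s.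
Proof.
move=> P0 P1 P2 P3 [[|[|[|[|//]]]] lt_s].
- by rewrite (_ : Ordinal _ = 0) //; apply: val_inj.
- by rewrite (_ : Ordinal _ = 1) //; apply: val_inj.
- by rewrite (_ : Ordinal _ = 2) //; apply: val_inj.
- by rewrite (_ : Ordinal _ = 3) //; apply: val_inj.
Qed.

Lemma Z4_eq (s t : 'Z_4) : (s : nat) = t -> s = t.
Proof. exact: val_inj. Qed.

Lemma Z4_add1 :
  [/\ 0 + 1 = 1 :> 'Z_4, 1 + 1 = 2 :> 'Z_4, 2 + 1 = 3 :> 'Z_4 & 3 + 1 = 0 :> 'Z_4].
Proof. by split; apply: Z4_eq. Qed.

Lemma Z4_add2 :
  [/\ 0 + 2 = 2 :> 'Z_4, 1 + 2 = 3 :> 'Z_4, 2 + 2 = 0 :> 'Z_4 & 3 + 2 = 1 :> 'Z_4].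
Proof. by split; apply: Z4_eq. Qed.

Lemma sum_Z4 (V : nmodType) (F : 'Z_4 -> V) : \sum_s F s = F 0 + F 1 + F 2 + F 3.
Proof.
rewrite !big_ord_recr big_ord0 /= add0r.
by congr (_ + _ + _ + _); congr F; apply: Z4_eq.
Qed.

Section Darts.
Variable D : diagram.
Implicit Types (d : dart D) (c : D) (s : 'Z_4).

(** With the slots in counterclockwise order, [turn] is the rotation about a
    crossing: [face_step] is [turn] after [glue].  The opposite dart [across] is
    the continuation of the strand through the crossing. *)
Definition turn d : dart D := (d.1, d.2 + 1).
Definition across d : dart D := (d.1, d.2 + 2).

Lemma turn4 d : turn (turn (turn (turn d))) = d.
Proof. by case: d => c s; congr pair; elim/Z4_ind: s; apply: Z4_eq. Qed.

Lemma turn_turn d : turn (turn d) = across d.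
Proof. by case: d => c s; congr pair; rewrite -addrA; congr (_ + _); apply: Z4_eq. Qed.

Lemma acrossK : involutive across.
Proof. by move=> d; rewrite -!turn_turn turn4. Qed.

Lemma outgoing_across d : outgoing (across d) = ~~ outgoing d.
Proof.
by case: d => c s; rewrite /outgoing /=; case: (positive c); elim/Z4_ind: s.
Qed.

Lemma smoothing_inv (S : {set D}) c : involutive (smoothing S c).
Proof. by move=> s; rewrite /smoothing; case: (c \in S); rewrite subKr. Qed.

Lemma smoothing_const (W : Type) (h : dart D -> W) (S : {set D}) c :
  (forall s, h (c, smoothing S c s) = h (c, s)) <->
  (if c \in S then h (c, 0) = h (c, 1) /\ h (c, 2) = h (c, 3)
   else h (c, 1) = h (c, 2) /\ h (c, 3) = h (c, 0)).
Proof.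
have [s0 s1 s2 s3] : [/\ smoothing S c 0 = (if c \in S then 1 else 3),
    smoothing S c 1 = (if c \in S then 0 else 2),
    smoothing S c 2 = (if c \in S then 3 else 1)
  & smoothing S c 3 = (if c \in S then 2 else 0)].
  by rewrite /smoothing; case: (c \in S); split; apply: Z4_eq.
case: ifP s0 s1 s2 s3 => _ s0 s1 s2 s3; split=> [H|[H1 H2] s].
- by rewrite -(H 0) -(H 2) s0 s2.
- by elim/Z4_ind: s; rewrite ?s0 ?s1 ?s2 ?s3.
- by rewrite -(H 1) -(H 3) s1 s3.
- by elim/Z4_ind: s; rewrite ?s0 ?s1 ?s2 ?s3.
Qed.

Lemma sum_dart (V : nmodType) (F : dart D -> V) :
  \sum_d F d = \sum_c \sum_s F (c, s).
Proof. by rewrite pair_bigA; apply: eq_bigr => -[]. Qed.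

End Darts.

Section Oriented.
Variable D : diagram.
Hypothesis Dor : oriented D.
Implicit Types (d : dart D) (c : D) (s : 'Z_4).

Let glueK : involutive (@glue D). Proof. by case: Dor. Qed.
Let outgoing_glue d : outgoing (glue d) = ~~ outgoing d.
Proof. by case: Dor => _; apply. Qed.

(** [glue] exchanges outgoing and incoming darts, so that half of the
    4 n darts are outgoing: a diagram with n crossings has 2 n edges. *)
Lemma card_dart_outgoing : #|[set d : dart D | outgoing d]| = (2 * #|D|)%N.
Proof.
have := cardsC [set d : dart D | outgoing d].
have -> : ~: [set d : dart D | outgoing d] = @glue D @: [set d : dart D | outgoing d].
  apply/setP => d; rewrite !inE; apply/idP/imsetP => [od|[d' + ->]].
    by exists (glue d); rewrite ?glueK // inE outgoing_glue.
  by rewrite inE outgoing_glue => ->.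
rewrite card_imset; last exact: inv_inj.
have -> : #|dart D| = (2 * (2 * #|D|))%N by rewrite card_prod card_ord /= mulnA mulnC.
by rewrite addnn -mul2n => /eqP; rewrite eqn_pmul2l // => /eqP.
Qed.

Lemma curve_connect_sym (link : D -> 'Z_4 -> 'Z_4) :
    (forall c, involutive (link c)) ->
  connect_sym [rel d d' : dart D | (d' == glue d) || (d' == (d.1, link d.1 d.2))].
Proof.
move=> linkK; apply: sym_connect_sym => d d' /=.
congr (_ || _); apply/eqP/eqP => ->; rewrite ?glueK //=.
- by rewrite linkK; case: d.
- by rewrite linkK; case: d'.
Qed.

(** This turns the loop value #|k| of a state sum into a sum over colourings. *)
Lemma card_curve_functions (link : D -> 'Z_4 -> 'Z_4) (k : finType) :
    (forall c, involutive (link c)) -> circles D = 0%N ->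
  #|[set h : {ffun dart D -> k} |
      [forall d, (h (glue d) == h d) && (h (d.1, link d.1 d.2) == h d)]]|
  = (#|k| ^ curves link)%N.
Proof.
move=> linkK c0; rewrite /curves c0 add0n.
apply: card_const_comp => [|h]; first exact: curve_connect_sym.
apply: (iffP forallP) => [hP d d' /= | hP d].
  by have /andP[/eqP h1 /eqP h2] := hP d; case/orP => /eqP->.
by apply/andP; split; apply/eqP/esym/hP; rewrite /= eqxx ?orbT.
Qed.

Section Knot.
Hypothesis Dknot : components D = 1%N.
Variable d0 : dart D.

Let across_inv c : involutive (fun s : 'Z_4 => s + 2).
Proof. by move=> s; elim/Z4_ind: s; apply: Z4_eq. Qed.

Lemma knot_circles : circles D = 0%N.
Proof.
move: Dknot; rewrite /components /curves.
have := n_comp_gt0 (curve_connect_sym across_inv) d0.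
by case: (n_comp _ _) => // n _ /eqP; rewrite addnS eqSS addn_eq0 => /andP[/eqP].
Qed.

Lemma curves_gt0 (link : D -> 'Z_4 -> 'Z_4) :
  (forall c, involutive (link c)) -> (0 < curves link)%N.
Proof.
by move=> linkK; rewrite addn_gt0 (n_comp_gt0 (curve_connect_sym linkK) d0) orbT.
Qed.

(** How the hypothesis of a single component enters everywhere: a quantity
    invariant along edges and through crossings is constant. *)
Lemma knot_const (W : Type) (f : dart D -> W) :
    (forall d, f (glue d) = f d) -> (forall d, f (across d) = f d) ->
  forall d d', f d = f d'.
Proof.
move=> fg fa d d'; move: Dknot; rewrite /components /curves knot_circles add0n.
move/(n_comp_connect1 (curve_connect_sym across_inv))/(_ d d').
by apply: connect_const => x y /= /orP[] /eqP->; rewrite ?fg ?fa.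
Qed.

Lemma knot_crossing_const (W : Type) (z : D -> W) :
  (forall d, z (glue d).1 = z d.1) -> forall c c', z c = z c'.
Proof.
by move=> zg c c'; apply: (knot_const (f := fun d => z d.1) _ _ (c, 0) (c', 0)).
Qed.

Lemma connected_parts_knot : connected_parts D = 1%N.
Proof.
rewrite /connected_parts; set e := [rel d d' | _].
have e_sym : connect_sym e.
  apply: sym_connect_sym => d d' /=; rewrite [_.1 == _]eq_sym; congr (_ || _).
  by apply/eqP/eqP => ->; rewrite glueK.
have conn d : fingraph.root e d = fingraph.root e d0.
  apply: knot_const => {}d; apply/esym/(fingraph.rootP e_sym)/connect1 => /=.
    by rewrite eqxx.
  by rewrite eqxx orbT.
apply/eqP/card1P; exists (fingraph.root e d0) => d; rewrite !inE andbT.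
apply/idP/eqP => [/eqP <-|->]; [exact: conn | exact: roots_root].
Qed.

Hypothesis Dpl : planar D.

(** * Functions on the faces and exactness on the sphere *)
Section Faces.
Variable q : nat.
Hypothesis q_pr : prime q.
(** The dart d stands for the face on its right, which is the corner between
    the slots d.2 - 1 and d.2.  The face on its left is that of [turn d], and
    also the face on the right of [glue d]. *)
Definition face_functions : {set {ffun dart D -> 'F_q}} :=
  [set f : {ffun dart D -> 'F_q} | [forall d, f (turn d) == f (glue d)]].

Lemma face_functionsP (f : {ffun dart D -> 'F_q}) :
  reflect (forall d, f (turn d) = f (glue d)) (f \in face_functions).
Proof. by rewrite inE; apply: (iffP forallP) => h d; apply/eqP. Qed.

Lemma face_closed : zmod_closed face_functions.
Proof.
split=> [|f g /face_functionsP Hf /face_functionsP Hg]; apply/face_functionsP => d.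
  by rewrite !ffunE.
by rewrite !ffunE Hf Hg.
Qed.

(** The Euler formula: a connected diagram has n + 2 faces. *)
Lemma card_face_functions : #|face_functions| = (q ^ #|D|.+2)%N.
Proof.
have finj : injective (@face_step D).
  apply: (can_inj (g := fun d => glue (turn (turn (turn d))))) => d.
  by rewrite /face_step -/(turn _) turn4 glueK.
have := Dpl; rewrite /planar connected_parts_knot muln1 addn2 => <-.
rewrite -[X in (X ^ _)%N](card_Fp q_pr).
apply: card_const_comp => [|f]; first exact: fconnect_sym.
apply: (iffP forallP) => [fP d _ /= /eqP<-|fP d].
  by rewrite -[RHS]/(f (turn (glue d))) (eqP (fP _)) glueK.
have /fP -> : frel (@face_step D) (glue d) (turn d) by rewrite /= /face_step glueK.
by [].
Qed.

Lemma card_const_functions (T : finType) (x0 : T) :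
  #|[set f : {ffun T -> 'F_q} | [forall x, f x == f x0]]| = q.
Proof.
have cinj : injective (fun a : 'F_q => [ffun _ : T => a]).
  by move=> a b /ffunP/(_ x0); rewrite !ffunE.
rewrite -[RHS](card_Fp q_pr) -(card_imset _ cinj); apply: eq_card => f.
rewrite inE; apply/forallP/imsetP => [fP|[a _ ->] x]; last by rewrite !ffunE.
by exists (f x0) => //; apply/ffunP => x; rewrite ffunE (eqP (fP x)).
Qed.

(** The jump of f across the edge of d. *)
Definition grad (f : {ffun dart D -> 'F_q}) d := f (turn d) - f d.

Lemma grad_glue f : f \in face_functions -> forall d, grad f (glue d) = - grad f d.
Proof. by move=> /face_functionsP fP d; rewrite /grad !fP glueK opprB. Qed.

Lemma grad_const f : (f \in face_functions) ->
  (forall d, grad f d = 0) -> forall d, f d = f d0.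
Proof.
move=> /face_functionsP fP g0 d.
have ft x : f (turn x) = f x by apply/eqP; rewrite -subr_eq0; apply/eqP/g0.
by apply: knot_const => {}d; rewrite -?turn_turn ?ft // -fP ft.
Qed.

(** An antisymmetric function on darts is a function on edges oriented by the
    knot; it is stored by its values on the outgoing darts. *)
Definition outgoing_part (e : dart D -> 'F_q) : {ffun dart D -> 'F_q} :=
  [ffun d => if outgoing d then e d else 0].

Definition cograd (z : {ffun D -> 'F_q}) : {ffun dart D -> 'F_q} :=
  [ffun d => z d.1 - z (glue d).1].

(** Adjunction between the boundary of a chain of edges and the differences of a
    function on crossings. *)
Lemma pairing_cograd e z : (forall d, e (glue d) = - e d) ->
  pairing (outgoing_part e) (cograd z) = \sum_c z c * \sum_s e (c, s).
Proof.
move=> eg; under [RHS]eq_bigr do rewrite mulr_sumr.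
rewrite -(sum_dart (fun d => z d.1 * e d)).
rewrite /pairing (bigID (@outgoing D)) /= [X in _ + X]big1 ?addr0; last first.
  by move=> d /negPf nd; rewrite ffunE nd mul0r.
rewrite [RHS](bigID (@outgoing D)) /= [X in _ = _ + X](reindex_inj (inv_inj glueK)) /=.
rewrite [X in _ = _ + X](eq_bigl (@outgoing D)); last first.
  by move=> d; rewrite outgoing_glue negbK.
rewrite -big_split /=; apply: eq_bigr => d od.
by rewrite !ffunE od eg mulrN -mulrBl mulrC.
Qed.

(** The image of [grad] has q ^ (n + 2) / q elements.  It lies in the space X of
    cycles, which by duality with [cograd] has q ^ (2 n) * q / q ^ n elements since
    only constants have zero differences along a connected diagram.  The two
    counts agree, so every cycle is a gradient. *)
Lemma grad_exact (e : dart D -> 'F_q) :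
    (forall d, e (glue d) = - e d) -> (forall c, \sum_s e (c, s) = 0) ->
  exists2 f, f \in face_functions & forall d, e d = grad f d.
Proof.
move=> eg ec; pose O := [set d : dart D | outgoing d].
pose al f := outgoing_part (grad f).
have alB : {morph al : f g / f - g}.
  by move=> f g; apply/ffunP => d; rewrite !ffunE; case: ifP => _;
    rewrite ?subr0 // /grad !ffunE !opprD !opprK addrACA.
have cogradB : {morph cograd : f g / f - g}.
  by move=> f g; apply/ffunP => d; rewrite !ffunE !opprD !opprK addrACA.
pose X := annihilator (cograd @: setT) :&: supported q O.
have inX e' : (forall d, e' (glue d) = - e' d) -> (forall c, \sum_s e' (c, s) = 0) ->
    outgoing_part e' \in X.
  move=> eg' ec'; rewrite inE; apply/andP; split; rewrite inE.
    apply/forall_inP => _ /imsetP[z _ ->]; rewrite pairing_cograd // big1 // => c _.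
    by rewrite ec' mulr0.
  by apply/forallP => d; apply/implyP; rewrite inE ffunE => /negPf->.
have cX : #|X| = (q ^ #|D|.+1)%N.
  have clT : zmod_closed [set: {ffun D -> 'F_q}] by split=> [|x y _ _]; rewrite inE.
  have := card_annihilator O q_pr clT cogradB.
  rewrite -/X card_dart_outgoing cardsT card_ffun card_Fp //.
  rewrite (_ : [set x in _ | _] = [set z : {ffun D -> 'F_q} | [forall c, z c == z d0.1]]).
    rewrite card_const_functions mul2n -addnn expnD expnS => /eqP.
    by rewrite -mulnA [(_ * q)%N]mulnC mulnC eqn_pmul2l ?expn_gt0 ?prime_gt0 // => /eqP.
  apply/setP => z; rewrite !inE /=; apply/forall_inP/forallP => [zP c|zP d _].
    apply/eqP/knot_crossing_const => d; apply/eqP.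
    case: (boolP (outgoing d)) => od.
      by have := zP d; rewrite inE ffunE subr_eq0 eq_sym; apply.
    by have := zP (glue d); rewrite inE outgoing_glue od ffunE glueK subr_eq0; apply.
  by rewrite ffunE (eqP (zP _)) (eqP (zP (glue d).1)) subrr.
have sub : al @: face_functions \subset X.
  apply/subsetP => _ /imsetP[f fP ->]; apply: inX => [|c]; first exact: grad_glue.
  rewrite /grad /turn /= sumrB; apply/eqP; rewrite subr_eq0 eq_sym; apply/eqP.
  by rewrite (reindex_inj (addIr 1)).
have := card_fibers face_closed alB; rewrite card_face_functions.
rewrite (_ : [set x in _ | _] = [set f : {ffun dart D -> 'F_q} | [forall d, f d == f d0]]).
  rewrite card_const_functions expnSr => /eqP; rewrite eqn_pmul2r ?prime_gt0 //.
  rewrite -cX => /eqP cA.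
  have /eqP XE : al @: face_functions == X by rewrite eqEcard sub cA leqnn.
  have : outgoing_part e \in X by apply: inX.
  rewrite -XE => /imsetP[f fP ef]; exists f => // d.
  have ed x : outgoing x -> e x = grad f x.
    by move=> ox; have /ffunP/(_ x) := ef; rewrite !ffunE ox.
  case: (boolP (outgoing d)) => od; first exact: ed.
  have := ed (glue d); rewrite outgoing_glue => /(_ od).
  by rewrite eg grad_glue // => /oppr_inj.
apply/setP => f; rewrite !inE; apply/andP/forallP => [[fP /eqP a0] d|fP].
  apply/eqP/grad_const; first by apply/face_functionsP => x; apply/eqP/(forallP fP).
  have g0 x : outgoing x -> grad f x = 0.
    by move=> ox; have /ffunP/(_ x) := a0; rewrite !ffunE ox.
  have fF : f \in face_functions by rewrite inE.
  move=> x; case: (boolP (outgoing x)) => ox; first exact: g0.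
  by apply/oppr_inj; rewrite -grad_glue // g0 ?oppr0 // outgoing_glue.
split; first by apply/forallP => d; rewrite (eqP (fP _)) (eqP (fP (glue d))).
apply/eqP/ffunP => d; rewrite !ffunE /grad (eqP (fP _)) (eqP (fP d)) subrr.
by case: ifP.
Qed.

End Faces.

(** * The checkerboard colouring and duality between the colours *)

(** Every crossing has four edges, so over F_2 the function 1 is a cycle, and a
    face function with gradient 1 changes across every edge. *)
Lemma checkerboard : exists black : dart D -> bool,
  (forall d, black (turn d) = ~~ black d) /\ (forall d, black (glue d) = ~~ black d).
Proof.
have [f /face_functionsP fP f1] : exists2 f, f \in face_functions 2 &
    forall d, (fun=> 1) d = grad f d.
  apply: grad_exact => // [d|c]; last rewrite /= sumr_const card_ord.
    by apply/eqP. by apply/eqP.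
have fS d : f (turn d) = f d + 1 by rewrite [X in _ + X](f1 d) addrC subrK.
exists (fun d => f d == 0).
suff E d : (f (turn d) == 0) = ~~ (f d == 0) by split=> d; rewrite -?fP E.
by rewrite fS; case: (f d) => -[|[|//]] lt_f.
Qed.

Section Colour.
Variables (q : nat) (q_pr : prime q).

(** Functions on the faces that vanish on the faces that are not black. *)
Definition colour_functions (black : dart D -> bool) : {set {ffun dart D -> 'F_q}} :=
  [set f : {ffun dart D -> 'F_q} in face_functions q | [forall d, ~~ black d ==> (f d == 0)]].

(** The difference between the two black corners of a crossing: they are the
    slots 0 and 2, or 1 and 3. *)
Definition corner_diff (black : dart D -> bool) (f : {ffun dart D -> 'F_q}) :
    {ffun D -> 'F_q} :=
  [ffun c => if black (c, 0) then f (c, 0) - f (c, 2) else f (c, 1) - f (c, 3)].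

Definition joined_functions black (J : {set D}) : {set {ffun dart D -> 'F_q}} :=
  [set f in colour_functions black | [forall c in J, corner_diff black f c == 0]].

Lemma corner_diffB black : {morph corner_diff black : f g / f - g}.
Proof.
move=> f g; apply/ffunP => c; rewrite !ffunE; case: ifP => _;
by rewrite !opprD !opprK addrACA.
Qed.

Lemma colour_functionsP black f :
  reflect (f \in face_functions q /\ forall d, ~~ black d -> f d = 0)
          (f \in colour_functions black).
Proof.
rewrite [_ \in colour_functions _]in_set; apply: (iffP andP) => -[fF fE]; split=> //.
  by move=> d nd; apply/eqP; apply: (implyP (forallP fE d)).
by apply/forallP => d; apply/implyP => nd; rewrite fE.
Qed.

Lemma colour_closed black : zmod_closed (colour_functions black).
Proof.
have [F0 FB] := face_closed q.
split=> [|f g /colour_functionsP[fF f0] /colour_functionsP[gF g0]]; apply/colour_functionsP.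
  by split=> // d _; rewrite ffunE.
by split=> [|d nd]; rewrite ?FB // !ffunE f0 ?g0 ?subrr.
Qed.

Lemma joined_closed black J : zmod_closed (joined_functions black J).
Proof.
have [C0 CB] := colour_closed black.
split=> [|f g]; rewrite ![_ \in joined_functions _ _]in_set.
  rewrite C0 /=; apply/forall_inP => c _.
  by rewrite -(subrr 0) corner_diffB subrr ffunE.
move=> /andP[fC /forall_inP f0] /andP[gC /forall_inP g0].
apply/andP; split; first exact: CB.
by apply/forall_inP => c Jc; rewrite corner_diffB sub_ffunE (eqP (f0 c Jc)) (eqP (g0 c Jc)) subrr.
Qed.

(** The sum over all darts of f d * g (turn d) is symmetric in f and g because
    [glue] exchanges the two faces of a dart; expanding around a crossing gives
    the symplectic form below.  When f is black and g is white, one of the two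
    products vanishes at each crossing. *)
Lemma corner_symplectic f g : f \in face_functions q -> g \in face_functions q ->
  \sum_c ((f (c, 0) - f (c, 2)) * (g (c, 1) - g (c, 3))
          - (g (c, 0) - g (c, 2)) * (f (c, 1) - f (c, 3))) = 0.
Proof.
move=> /face_functionsP fF /face_functionsP gF.
rewrite (eq_bigr (fun c => \sum_s (f (c, s) * g (c, s + 1) - g (c, s) * f (c, s + 1)))).
  rewrite -(sum_dart (fun d => f d * g (turn d) - g d * f (turn d))).
  rewrite sumrB; apply/eqP; rewrite subr_eq0; apply/eqP.
  rewrite (reindex_inj (inv_inj glueK)) /=; apply: eq_bigr => d _.
  by rewrite fF gF glueK mulrC.
move=> c _; rewrite sum_Z4.
case: Z4_add1 => -> -> -> ->.
move: (f (c, 0)) (f (c, 1)) (f (c, 2)) (f (c, 3)) (g (c, 0)) (g (c, 1)) (g (c, 2)) (g (c, 3)).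
move: ('F_q : comPzRingType) => R x0 x1 x2 x3 y0 y1 y2 y3; ring.
Qed.

Section OneColour.
Variable black : dart D -> bool.
Hypothesis blackT : forall d, black (turn d) = ~~ black d.
Hypothesis blackG : forall d, black (glue d) = ~~ black d.

Lemma black_slots c : [/\ black (c, 1) = ~~ black (c, 0), black (c, 2) = black (c, 0)
  & black (c, 3) = ~~ black (c, 0)].
Proof.
have t0 : turn (c, 0) = (c, 1) :> dart D by congr pair; apply: Z4_eq.
have t1 : turn (c, 1) = (c, 2) :> dart D by congr pair; apply: Z4_eq.
have t2 : turn (c, 2) = (c, 3) :> dart D by congr pair; apply: Z4_eq.
have e1 : black (c, 1) = ~~ black (c, 0) by rewrite -t0 blackT.
have e2 : black (c, 2) = black (c, 0) by rewrite -t1 blackT e1 negbK.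
by split=> //; rewrite -t2 blackT e2.
Qed.

Lemma corner_diff_eq0 f : f \in colour_functions black -> corner_diff black f = 0 ->
  forall d, f (across d) = f d.
Proof.
move=> /colour_functionsP[fF f0] /ffunP df0 [c s].
have [e1 e2 e3] := black_slots c.
have := df0 c; rewrite !ffunE.
have a s' : across (c, s') = (c, s' + 2) :> dart D by [].
rewrite a; case: Z4_add2 => E0 E1 E2 E3.
case: ifP => e0 /eqP; rewrite subr_eq0 => /eqP e;
  elim/Z4_ind: s; rewrite ?E0 ?E1 ?E2 ?E3 //;
  by rewrite !f0 ?e1 ?e2 ?e3 ?e0.
Qed.

(** A black function without corner differences takes the same value on the two
    black corners of every crossing, hence a constant value along the knot. *)
Lemma card_corner_diff_ker :
  #|[set f in colour_functions black | corner_diff black f == 0%R]| = q.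
Proof.
(* The kernel is the line spanned by the indicator of the black faces. *)
pose line (a : 'F_q) : {ffun dart D -> 'F_q} := [ffun d => if black d then a else 0].
have [b eb] : exists b, black b.
  by case e0: (black d0); [exists d0 | exists (turn d0); rewrite blackT e0].
have linj : injective line by move=> a a' /ffunP/(_ b); rewrite !ffunE eb.
rewrite -[RHS](card_Fp q_pr) -(card_imset _ linj); apply: eq_card => f.
rewrite in_set; apply/andP/imsetP => [[fC /eqP df0]|[a _ ->]].
  have fa := corner_diff_eq0 fC df0.
  have /colour_functionsP[/face_functionsP fF f0] := fC.
  exists (f b) => //; apply/ffunP => d; rewrite ffunE; case: ifP => [ed|/negbT]; last exact: f0.
  have := @knot_const _ (fun d => f d + f (turn d)) _ _ d b.
  rewrite (f0 (turn d)) ?(f0 (turn b)) ?blackT ?ed ?eb // !addr0; apply=> {ed}d.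
    by rewrite !fF glueK addrC.
  by rewrite (_ : turn (across d) = across (turn d)) ?fa // -!turn_turn.
split.
  apply/colour_functionsP; split; last by move=> d /negPf nd; rewrite ffunE nd.
  by apply/face_functionsP => d; rewrite !ffunE blackT blackG.
apply/eqP/ffunP => c; rewrite !ffunE; have [-> -> ->] := black_slots c.
by case: (black _); rewrite /= subrr.
Qed.

(** A face function is the sum of its black and white parts. *)
Lemma card_colours :
  (#|colour_functions black| * #|colour_functions (predC black)| = q ^ #|D|.+2)%N.
Proof.
pose al (f : {ffun dart D -> 'F_q}) : {ffun dart D -> 'F_q} :=
  [ffun d => if black d then f d else 0].
have alB : {morph al : f g / f - g}.
  by move=> f g; apply/ffunP => d; rewrite !ffunE; case: ifP; rewrite ?subrr.
rewrite -(card_face_functions q_pr) (card_fibers (face_closed q) alB); congr (_ * _)%N.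
  apply: eq_card => f; apply/colour_functionsP/imsetP => [[fF f0]|[g /face_functionsP gF ->]].
    exists f => //; apply/ffunP => d; rewrite ffunE; case: ifP => // /negbT; exact: f0.
  split; last by move=> d /negPf nd; rewrite ffunE nd.
  by apply/face_functionsP => d; rewrite !ffunE blackT blackG gF.
apply: eq_card => f; rewrite [RHS]in_set; apply/colour_functionsP/andP => -[fF f0]; split=> //.
  by apply/eqP/ffunP => d; rewrite !ffunE; case: ifP => // ed; apply: f0; rewrite /= ed.
by move=> d; rewrite /= negbK => ed; have /eqP/ffunP/(_ d) := f0; rewrite !ffunE ed.
Qed.

(** The white differences, with the sign that makes them orthogonal to the black
    ones in [corner_symplectic]. *)
Definition twisted_codiff (f : {ffun dart D -> 'F_q}) : {ffun D -> 'F_q} :=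
  [ffun c => (-1) ^+ (~~ black (c, 0)) * corner_diff (predC black) f c].

Lemma twisted_codiffB : {morph twisted_codiff : f g / f - g}.
Proof. move=> f g; apply/ffunP => c; rewrite !ffunE -mulrBr; congr (_ * _).
by case: ifP => _; rewrite !(opprD, opprK) addrACA.
Qed.

Lemma twisted_codiff_eq0 f c : (twisted_codiff f c == 0) = (corner_diff (predC black) f c == 0).
Proof. by rewrite ffunE mulf_eq0 signr_eq0. Qed.

End OneColour.

Lemma joined_setT black :
  joined_functions black setT = [set f in colour_functions black | corner_diff black f == 0].
Proof.
apply/setP => f; rewrite [LHS]in_set [RHS]in_set; congr (_ && _).
apply/forall_inP/eqP => [h|-> c _]; last by rewrite ffunE.
by apply/ffunP => c; rewrite [RHS]ffunE; apply/eqP/h.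
Qed.

Lemma joined_set0 black : joined_functions black set0 = colour_functions black.
Proof.
apply/setP => f; rewrite [LHS]in_set; case: (f \in _) => //=.
by apply/forall_inP => c; rewrite inE.
Qed.

Section Duality.
Variable black : dart D -> bool.
Hypothesis blackT : forall d, black (turn d) = ~~ black d.
Hypothesis blackG : forall d, black (glue d) = ~~ black d.

Let whiteT d : predC black (turn d) = ~~ predC black d.
Proof. by rewrite /= blackT. Qed.
Let whiteG d : predC black (glue d) = ~~ predC black d.
Proof. by rewrite /= blackG. Qed.

Lemma card_twisted_codiff_ker J :
  #|[set f in joined_functions (predC black) J | twisted_codiff black f == 0%R]| = q.
Proof.
rewrite -[RHS](card_corner_diff_ker whiteT whiteG); apply: eq_card => f.
rewrite [LHS]in_set [RHS]in_set [f \in joined_functions _ _]in_set -andbA.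
congr (_ && _); apply/andP/eqP => [[_ /eqP/ffunP h]|h].
  by apply/ffunP => c; apply/eqP; rewrite [X in _ == X]ffunE -twisted_codiff_eq0 h ffunE.
split; first by apply/forall_inP => c _; rewrite h ffunE.
by apply/eqP/ffunP => c; apply/eqP; rewrite [X in _ == X]ffunE twisted_codiff_eq0 h ffunE.
Qed.

(** The tensions of the black graph and those of the white one (its planar dual) are, up
    to signs, orthogonal complements: one inclusion is [corner_symplectic] and the
    orders agree by [card_colours]. *)
Lemma annihilator_corner_diff :
  annihilator (corner_diff black @: colour_functions black)
  = twisted_codiff black @: colour_functions (predC black).
Proof.
apply/eqP; rewrite eq_sym eqEcard; apply/andP; split.
  apply/subsetP => _ /imsetP[g /colour_functionsP[gF g0] ->].
  rewrite in_set; apply/forall_inP => _ /imsetP[f /colour_functionsP[fF f0] ->].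
  apply/eqP; rewrite -[RHS](corner_symplectic fF gF); apply: eq_bigr => c _.
  have [e1 e2 e3] := black_slots blackT c.
  rewrite !ffunE /=; case e0: (black (c, 0)) e1 e2 e3 => /= e1 e2 e3.
    rewrite (g0 (c, 0)) ?(g0 (c, 2)) /= ?e2 ?e0 // subrr mul0r subr0.
    by rewrite mul1r mulrC.
  rewrite (f0 (c, 0)) ?(f0 (c, 2)) ?e2 ?e0 // subrr mul0r sub0r.
  by rewrite expr1 mulN1r mulNr.
have q0 := prime_gt0 q_pr.
have := card_annihilator setT q_pr (colour_closed black) (@corner_diffB black).
have := card_fibers (joined_closed (predC black) set0) (@twisted_codiffB black).
have suppT : supported q [set: D] = setT.
  by apply/setP => g; rewrite !inE; apply/forallP => c; rewrite inE.
rewrite suppT setIT cardsT -/(joined_functions black setT) joined_setT.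
rewrite (card_corner_diff_ker blackT blackG) card_twisted_codiff_ker joined_set0 => cF cA.
have cC := card_colours blackT blackG.
have cE : (0 < #|colour_functions black|)%N.
  by apply/card_gt0P; exists 0; case: (colour_closed black).
rewrite -(leq_pmul2r cE) -(leq_pmul2r q0) cA -expnSr -(leq_pmul2r q0) -expnSr -cC cF.
by apply/eq_leq; ring.
Qed.

(** Up to constants, a white function without jumps off J is an element of the
    annihilator of the black differences supported on J, and
    [card_annihilator] counts these. *)
Lemma card_joined_dual (J : {set D}) :
  (#|joined_functions (predC black) (~: J)| * #|colour_functions black|
   = q * q ^ #|J| * #|joined_functions black J|)%N.
Proof.
have := card_fibers (joined_closed (predC black) (~: J)) (@twisted_codiffB black).
rewrite card_twisted_codiff_ker => ->.
have := card_annihilator J q_pr (colour_closed black) (@corner_diffB black).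
rewrite -/(joined_functions black J) -(mulnA q) => <-.
rewrite annihilator_corner_diff mulnAC [RHS]mulnC; congr (_ * _ * _)%N.
apply: eq_card => g; rewrite [RHS]in_setI.
apply/imsetP/andP => [[f + ->]|[/imsetP[f fC ->] gJ]].
  rewrite in_set => /andP[fC /forall_inP f0]; split; first exact: imset_f.
  rewrite in_set; apply/forallP => c; apply/implyP => nJ.
  by rewrite twisted_codiff_eq0; apply: f0; rewrite inE.
exists f => //; rewrite in_set fC; apply/forall_inP => c; rewrite inE => nJ.
move: gJ; rewrite in_set => /forallP/(_ c)/implyP/(_ nJ).
by rewrite twisted_codiff_eq0.
Qed.

(** * Counting the curves of a state *)

(** Functions on the regions of the state S: the A-smoothing merges the corners
    that stand at slots 0 and 2, the B-smoothing those at slots 1 and 3. *)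
Definition consistent_functions (S : {set D}) : {set {ffun dart D -> 'F_q}} :=
  [set f in face_functions q | [forall c : D,
    if c \in S then f (c, 0) == f (c, 2) else f (c, 1) == f (c, 3)]].

Lemma consistent_closed S : zmod_closed (consistent_functions S).
Proof.
have [F0 FB] := face_closed q.
split=> [|f g]; rewrite ![_ \in consistent_functions S]in_set.
  by rewrite F0; apply/forallP => c; rewrite !ffunE !eqxx if_same.
move=> /andP[fF /forallP fP] /andP[gF /forallP gP]; rewrite FB //=.
apply/forallP => c; have := fP c; have := gP c; rewrite !sub_ffunE.
by case: ifP => _ /eqP-> /eqP->.
Qed.

(** The crossings whose smoothing in S merges the two black corners. *)
Definition black_joined (S : {set D}) : {set D} := [set c | (c \in S) == black (c, 0)].

(** Black regions and white regions are coloured independently. *)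
Lemma card_consistent_colours (S : {set D}) :
  #|consistent_functions S|
  = (#|joined_functions black (black_joined S)|
     * #|joined_functions (predC black) (~: black_joined S)|)%N.
Proof.
pose al (f : {ffun dart D -> 'F_q}) : {ffun dart D -> 'F_q} :=
  [ffun d => if black d then f d else 0].
have alB : {morph al : f g / f - g}.
  by move=> f g; apply/ffunP => d; rewrite !ffunE; case: ifP; rewrite ?subrr.
have diff0 e (f : {ffun dart D -> 'F_q}) c : (forall d, black d = e -> f d = 0) ->
    corner_diff (if e then black else predC black) f c = 0.
  move=> f0; have [e1 e2 e3] := black_slots blackT c.
  case: e f0 => f0; rewrite ffunE /=; case: ifP => e0;
    by rewrite !f0 ?subrr ?e1 ?e2 ?e3 ?e0 //; apply: negbTE.
have diff_al f c : corner_diff black (al f) c = corner_diff black f c.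
  have [e1 e2 e3] := black_slots blackT c.
  by rewrite !ffunE /= e1 e2 e3; case: (black _).
have consP (f : {ffun dart D -> 'F_q}) c :
    (if c \in S then f (c, 0) == f (c, 2) else f (c, 1) == f (c, 3))
    = (corner_diff (if c \in black_joined S then black else predC black) f c == 0).
  rewrite in_set; case: (c \in S); case e0: (black (c, 0));
    by rewrite ffunE /= e0 /= subr_eq0.
rewrite (card_fibers (consistent_closed S) alB); congr (_ * _)%N; apply: eq_card => f.
  apply/imsetP/idP => [[g + ->]|].
    rewrite in_set => /andP[/face_functionsP gF /forallP gP].
    rewrite in_set; apply/andP; split.
      apply/colour_functionsP; split; last by move=> d /negPf nd; rewrite ffunE nd.
      by apply/face_functionsP => d; rewrite !ffunE blackT blackG gF.
    by apply/forall_inP => c Jc; have := gP c; rewrite consP Jc diff_al.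
  rewrite in_set => /andP[/colour_functionsP[fF f0] /forall_inP fJ].
  exists f; last by apply/ffunP => d; rewrite ffunE; case: ifP => // /negbT /f0.
  rewrite in_set fF; apply/forallP => c; rewrite consP.
  case: ifP => [/fJ //|_]; apply/eqP/(diff0 false) => d nd.
  by apply: f0; rewrite nd.
rewrite in_set [RHS]in_set [f \in consistent_functions S]in_set.
apply/andP/andP => [[/andP[fF /forallP fP] /eqP/ffunP al0]|].
  split; last first.
    apply/forall_inP => c; rewrite inE => /negPf nJ.
    by have := fP c; rewrite consP nJ.
  apply/colour_functionsP; split=> // d; rewrite /= negbK => ed.
  by have := al0 d; rewrite !ffunE ed.
move=> [/colour_functionsP[fF f0] /forall_inP fJ].
have f1 d : black d = true -> f d = 0 by move=> ed; apply: f0; rewrite /= ed.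
split; last by apply/eqP/ffunP => d; rewrite !ffunE; case: ifP => // /f1.
rewrite fF; apply/forallP => c; rewrite consP.
case: ifP => [_|nJ]; first exact/eqP/(diff0 true).
by apply: fJ; rewrite inE nJ.
Qed.

(** The jump of a region function is constant along each curve once its sign is
    fixed by the side, left or right, on which the black region lies.
    Conversely such a function of the curves is a cycle, hence a gradient by
    [grad_exact].  Constant functions account for the factor q. *)
Lemma card_consistent_curves (S : {set D}) :
  #|consistent_functions S| = (q * q ^ curves (smoothing S))%N.
Proof.
pose sg d (a : 'F_q) := if black d then - a else a.
have sgK d : involutive (sg d) by move=> a; rewrite /sg; case: (black d) => //; rewrite opprK.
pose al (f : {ffun dart D -> 'F_q}) : {ffun dart D -> 'F_q} := [ffun d => sg d (grad f d)].
have alB : {morph al : f g / f - g}.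
  move=> f g; apply/ffunP => d; rewrite !ffunE /sg /grad !sub_ffunE.
  by case: ifP => _; rewrite !(opprD, opprK) addrACA.
have gradE (f : {ffun dart D -> 'F_q}) c :
    [/\ grad f (c, 0) = f (c, 1) - f (c, 0), grad f (c, 1) = f (c, 2) - f (c, 1),
    grad f (c, 2) = f (c, 3) - f (c, 2) & grad f (c, 3) = f (c, 0) - f (c, 3)].
  by case: Z4_add1 => E0 E1 E2 E3; rewrite /grad /turn /= E0 E1 E2 E3.
rewrite (card_fibers (consistent_closed S) alB) mulnC; congr (_ * _)%N.
  rewrite -[RHS](card_const_functions q_pr d0); apply: eq_card => f.
  rewrite in_set [RHS]in_set [f \in consistent_functions S]in_set.
  apply/andP/forallP => [[/andP[fF _] /eqP/ffunP al0] d|fP].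
    apply/eqP/(grad_const fF) => {}d; apply: (can_inj (sgK d)).
    by have := al0 d; rewrite !ffunE => ->; rewrite /sg oppr0 if_same.
  have fE d d' : f d = f d' by rewrite (eqP (fP d)) (eqP (fP d')).
  split; last first.
    apply/eqP/ffunP => d; rewrite !ffunE /grad (fE _ d) subrr /sg oppr0 if_same //.
  apply/andP; split; first by apply/face_functionsP.
  by apply/forallP => c; rewrite (fE (c, 0) (c, 2)) (fE (c, 1) (c, 3)) !eqxx if_same.
have := card_curve_functions 'F_q (smoothing_inv S) knot_circles.
rewrite card_Fp // => <-; apply: eq_card => h; rewrite [RHS]in_set.
apply/imsetP/forallP => [[f + ->] d|hP].
  rewrite in_set => /andP[fF /forallP fP].
  apply/andP; split; apply/eqP.
    by rewrite !ffunE grad_glue // /sg blackG; case: (black d); rewrite ?opprK.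
  case: d => c s /=; move: s; apply/smoothing_const; have := fP c.
  have [e1 e2 e3] := black_slots blackT c; have [g0 g1 g2 g3] := gradE f c.
  rewrite !ffunE /sg g0 g1 g2 g3 e1 e2 e3.
  by case: ifP => _ /eqP->; case: (black _); rewrite /= !opprB.
have hg d : h (glue d) = h d by have /andP[/eqP] := hP d.
have hl c : forall s, h (c, smoothing S c s) = h (c, s).
  by move=> s; have /andP[_ /eqP] := hP (c, s).
have [||f fF fh] := @grad_exact q q_pr (fun d => sg d (h d)).
- by move=> d; rewrite /sg blackG hg; case: (black d); rewrite ?opprK.
- move=> c; have /smoothing_const := hl c; rewrite sum_Z4.
  have [e1 e2 e3] := black_slots blackT c; rewrite /sg e1 e2 e3.
  case: ifP => _ [-> ->]; case: (black _) => /=.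
  + by rewrite addNr add0r addNr.
  + by rewrite subrr add0r subrr.
  + by rewrite addrK addNr.
  + by rewrite subrK subrr.
exists f; last by apply/ffunP => d; rewrite ffunE -fh sgK.
rewrite in_set fF; apply/forallP => c; have /smoothing_const := hl c.
have [e1 e2 e3] := black_slots blackT c; have [g0 g1 g2 g3] := gradE f c.
have := fh (c, 0); have := fh (c, 1); have := fh (c, 2); have := fh (c, 3).
rewrite g0 g1 g2 g3 /sg e1 e2 e3.
case: (c \in S) => h3 h2 h1 h0 [E1 E2].
  rewrite eq_sym -subr_eq0 -[f (c, 2)](subrK (f (c, 1))) -h1 -addrA -h0 E1.
  by case: (black _); rewrite /= ?subrr ?addNr.
rewrite eq_sym -subr_eq0 -[f (c, 3)](subrK (f (c, 2))) -h2 -addrA -h1 E1.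
by case: (black _); rewrite /= ?subrr ?addNr.
Qed.

(** The relation between loops and clusters of the spin model. *)
Lemma curves_smoothing : exists (V : nat) (b : {set D} -> nat),
  (forall S, #|joined_functions black (black_joined S)| = q ^ b S)%N /\
  (forall S, curves (smoothing S) + V = #|black_joined S| + 2 * b S)%N.
Proof.
have [V cV] := card_zmod_closed q_pr (colour_closed black).
have bP S : exists b, #|joined_functions black (black_joined S)| == (q ^ b)%N.
  by have [b ->] := card_zmod_closed q_pr (joined_closed black (black_joined S)); exists b.
exists V, (fun S => xchoose (bP S)); split=> S; first exact/eqP/(xchooseP (bP S)).
have /eqP cb := xchooseP (bP S); move: (xchoose _) cb => b cb.
have q0 := prime_gt0 q_pr.
apply/eqP; rewrite -(eqn_exp2l _ _ (prime_gt1 q_pr)) -(eqn_pmul2l q0); apply/eqP.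
rewrite (expnD q (curves _)) (expnD q #|_|) -cV [LHS]mulnA -card_consistent_curves card_consistent_colours.
by rewrite -mulnA card_joined_dual cb mul2n -addnn expnD; ring.
Qed.

End Duality.
End Colour.

(** * The bracket as a spin model *)
Section StateModel.
Variables (q : nat) (q_pr : prime q) (L : fieldType) (A : L).
Variable black : dart D -> bool.
Hypothesis blackT : forall d, black (turn d) = ~~ black d.
Hypothesis blackG : forall d, black (glue d) = ~~ black d.

Let delta : L := - A ^+ 2 - A ^- 2.

Hypothesis A_neq0 : A != 0.
Hypothesis delta_sqr : delta ^+ 2 = q%:R.
Hypothesis q_neq0 : q%:R != 0 :> L.

Let zeta : L := - A ^- 4.
Definition spin_weight (c : D) (a : 'F_q) : L :=
  if a == 0 then 1 else if black (c, 0) then zeta else zeta^-1.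

(** By [curves_smoothing], delta ^ c(S) is, up to a constant, the product of
    delta ^ j(S) and of the number of spin assignments f compatible with S.
    Exchanging the sums over S and f, the sum over S factors into crossings
    with factor delta A^e [f has no jump] + A^-e, where e = 1 or -1.  As
    delta A^e + A^-e = - A^(3 e), the ratio of the two possible values
    is (- A^-4) ^ e. *)
Lemma bracket_spin_sum : exists2 k : L, k != 0 &
  k * kauffman_bracket D A =
    \sum_(f in colour_functions q black) \prod_c spin_weight c (corner_diff black f c).
Proof.
have delta_neq0 : delta != 0 by apply: contraNneq q_neq0 => e; rewrite -delta_sqr e expr0n.
have [V [b [cb ccurves]]] := curves_smoothing q_pr blackT blackG.
pose w0 c : L := if black (c, 0) then - A ^+ 3 else - A ^- 3.
have w0_neq0 c : w0 c != 0.
  by rewrite /w0; case: ifP => _; rewrite oppr_eq0 ?invr_eq0 expf_neq0.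
pose j (S : {set D}) c := c \in black_joined black S.
pose wt (S : {set D}) (f : {ffun dart D -> 'F_q}) c : L :=
  (if c \in S then A else A^-1) *
  (if j S c then delta * (corner_diff black f c == 0)%:R else 1).
have bracketE : delta ^+ V.+1 * kauffman_bracket D A =
    \sum_(f in colour_functions q black) \sum_(S : {set D}) \prod_c wt S f c.
  rewrite exchange_big mulr_sumr; apply: eq_bigr => S _ /=.
  rewrite -/delta mulrCA exprSr -mulrA -exprS prednK; last first.
    exact/curves_gt0/smoothing_inv.
  rewrite -exprD addnC ccurves exprD exprM delta_sqr.
  rewrite -natrX -cb.
  rewrite state_weight //.
  have -> : delta ^+ #|black_joined black S| = \prod_c (if j S c then delta else 1).
    by rewrite -prodr_const [LHS]big_mkcond.
  have -> : #|joined_functions q black (black_joined black S)|%:R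
      = \sum_(f in colour_functions q black)
          \prod_c (if j S c then (corner_diff black f c == 0)%:R else 1) :> L.
    rewrite -sumr_const.
    rewrite (eq_bigl (fun f => (f \in colour_functions q black) &&
      [forall c in black_joined black S, corner_diff black f c == 0])); last first.
      by move=> f; rewrite in_set.
    rewrite big_mkcondr; apply: eq_bigr => f _.
    case: ifP => [/forall_inP h|/negbT].
      by rewrite big1 // => c _; case: ifP => // /h ->.
    rewrite negb_forall_in => /exists_inP[c Jc nz].
    by rewrite (bigD1 c) //= /j Jc (negPf nz) mul0r.
  rewrite !mulr_sumr; apply: eq_bigr => f _; rewrite -!big_split; apply: eq_bigr => c _ /=.
  by rewrite /wt; case: (j S c); rewrite ?mulr1 // -mulrA.
exists (delta ^+ V.+1 / \prod_c w0 c).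
  rewrite mulf_neq0 ?expf_neq0 // invr_eq0; apply/prodf_neq0 => c _; exact: w0_neq0.
apply: (mulfI (x := \prod_c w0 c)); first by apply/prodf_neq0 => c _; exact: w0_neq0.
rewrite mulrA [X in X * _]mulrCA divff ?mulr1; last by apply/prodf_neq0 => c _; exact: w0_neq0.
rewrite bracketE mulr_sumr; apply: eq_bigr => f _.
rewrite -big_split /=.
rewrite (eq_bigr (fun c =>
    (if black (c, 0) then A * (delta * (corner_diff black f c == 0)%:R) else A)
  + (if black (c, 0) then A^-1 else A^-1 * (delta * (corner_diff black f c == 0)%:R)))); last first.
  move=> c _; rewrite /w0 /spin_weight /zeta /delta.
  case: (black _); case: (_ == 0) => /=; field; rewrite ?A_neq0 ?oppr_eq0 ?oner_eq0 //.
rewrite [RHS]bigA_distr; apply: eq_bigr => S _; apply: eq_bigr => c _.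
rewrite /wt /j in_set; case: (c \in S); case: (black _) => //=; by rewrite ?mulr1.
Qed.

Lemma bracket_neq0_of_quadratic (z : L) (eta : D -> 'F_q) :
    q.-primitive_root z ->
    (forall c a b, spin_weight c (a + b)
       = spin_weight c a * spin_weight c b * chi z (eta c * a * b)) ->
    (forall u, u \in radical (colour_functions q black) (corner_diff black) eta ->
       \prod_c spin_weight c (corner_diff black u c) = 1) ->
  kauffman_bracket D A != 0.
Proof.
move=> z_prim wD w_rad; have [k k_neq0 kE] := bracket_spin_sum.
have wt_neq0 c a : spin_weight c a != 0.
  rewrite /spin_weight; case: ifP => _; first exact: oner_neq0.
  by case: ifP => _; rewrite ?invr_eq0 oppr_eq0 invr_eq0 expf_neq0.
apply: contraTneq (gauss_sum_neq0 q_pr z_prim q_neq0 (colour_closed q black)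
  (@corner_diffB q black) wt_neq0 wD w_rad) => b0.
by rewrite -kE b0 mulr0 eqxx.
Qed.

End StateModel.

Lemma prime_root_prim (R : idomainType) (q : nat) (z : R) :
  prime q -> z ^+ q = 1 -> z != 1 -> q.-primitive_root z.
Proof.
move=> q_pr zq z1; have [m zm mq] := prim_order_exists (prime_gt0 q_pr) zq.
suff m1 : m != 1%N by rewrite -(prime_nt_dvdP q_pr m1 mq).
by apply: contraNneq z1 => m1; rewrite -(prim_expr_order zm) m1 expr1.
Qed.

(** * The values at primitive roots of unity of order 4 and 6 *)

(** Here A^4 is a primitive sixth root of unity and zeta = - A^-4 a primitive
    cube root of unity, so the weights are zeta ^ (e a^2) for a in F_3.  The
    associated bilinear form takes the value 2 e a^2 on (a, a), which determines
    the weight, and so the weight is trivial on the radical. *)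
Lemma bracket_neq0_sixth (L : fieldType) (A : L) :
  A ^+ 8 - A ^+ 4 + 1 = 0 -> 3%:R != 0 :> L -> kauffman_bracket D A != 0.
Proof.
move=> A8 three_neq0; have [black [blackT blackG]] := checkerboard.
have A_neq0 : A != 0.
  by apply/eqP => A0; move/eqP: A8; rewrite A0 !expr0n /= subrr add0r oner_eq0.
pose zeta : L := - A ^- 4.
have zeta2 : zeta ^+ 2 + zeta + 1 = 0.
  by rewrite -[RHS](mulr0 (A ^- 8)) -A8 /zeta; field.
have zeta3 : zeta ^+ 3 = 1.
  have -> : zeta ^+ 3 = (zeta - 1) * (zeta ^+ 2 + zeta + 1) + 1 by ring.
  by rewrite zeta2 mulr0 add0r.
have zexp m n : m = n %[mod 3] -> zeta ^+ m = zeta ^+ n.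
  by move=> mn; rewrite -(expr_mod m zeta3) mn expr_mod.
have zetaV : zeta^-1 = zeta ^+ 2.
  have zu : zeta != 0 by rewrite oppr_eq0 invr_eq0 expf_neq0.
  by apply: (mulfI zu); rewrite divff // -exprS zeta3.
have delta2 : (- A ^+ 2 - A ^- 2) ^+ 2 = 3%:R.
  apply/eqP; rewrite -subr_eq0 -[X in _ == X](mulr0 (A ^- 4)) -A8; apply/eqP; by field.
have z_prim : 3.-primitive_root (zeta ^+ 2).
  apply: prime_root_prim => //; first by rewrite exprAC zeta3 expr1n.
  apply: contraNneq three_neq0 => z1.
  have e : zeta = 1 by rewrite -[LHS]mulr1 -z1 -exprS zeta3.
  by rewrite -zeta2 e; apply/eqP; ring.
pose e c : nat := if black (c, 0) then 1 else 2.
pose k (a : 'F_3) : nat := a != 0.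
have wE c a : spin_weight A black c a = zeta ^+ (e c * k a).
  rewrite /spin_weight -/zeta /e /k zetaV.
  by case: (a == 0); rewrite ?muln0 //; case: (black _); rewrite muln1.
pose eta c : 'F_3 := if black (c, 0) then 1 else - 1.
have chiE (a : 'F_3) : chi (zeta ^+ 2) a = zeta ^+ (2 * a) by rewrite /chi exprM.
have wD c a b : spin_weight A black c (a + b)
    = spin_weight A black c a * spin_weight A black c b * chi (zeta ^+ 2) (eta c * a * b).
  rewrite !wE chiE -!exprD /e /eta; apply: zexp.
  by case: (black _); case: a => [[|[|[|//]]] ?]; case: b => [[|[|[|//]]] ?].
apply: (@bracket_neq0_of_quadratic 3) wD _ => // u.
rewrite in_set => /andP[uC /forall_inP /(_ u uC) /eqP].
rewrite /polar => /(congr1 (chi (zeta ^+ 2))); rewrite chi0 (chi_sum _ z_prim) // => r1.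
rewrite -[LHS]mulr1 -[X in _ * X = _]r1 -big_split /=; apply: big1 => c _.
rewrite wE chiE -exprD -[RHS](expr0 zeta) /e /eta; apply: zexp.
by move: (corner_diff _ _ _) => a; case: (black _); case: a => [[|[|[|//]]] ?].
Qed.

(** A radical vector u has black differences orthogonal to all black differences,
    so they are the white differences of some v.  The face function u - v has,
    at each crossing, the same jump across both pairs of opposite corners; its
    gradient over F_2 is therefore constant along the strands, hence on the
    whole knot, and summing two consecutive jumps gives zero. *)
Lemma radical_F2 black (u : {ffun dart D -> 'F_2}) :
    (forall d, black (turn d) = ~~ black d) -> (forall d, black (glue d) = ~~ black d) ->
    u \in radical (colour_functions 2 black) (corner_diff black) (fun=> 1) ->
  corner_diff black u = 0.
Proof.
move=> blackT blackG; rewrite in_set => /andP[uC /forall_inP uR].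
have oppF2 (x : 'F_2) : - x = x by apply: val_inj; case: x => -[|[|//]].
have: corner_diff black u \in annihilator (corner_diff black @: colour_functions 2 black).
  rewrite in_set; apply/forall_inP => _ /imsetP[x xC ->].
  have := uR x xC; rewrite /polar /pairing.
  by under eq_bigr do rewrite mul1r.
rewrite annihilator_corner_diff // => /imsetP[v vC uv].
have {}uv c : corner_diff black u c = corner_diff (predC black) v c.
  rewrite uv [LHS]ffunE; case: (black _); rewrite /= ?expr1 ?mulN1r ?expr0 ?mul1r //.
have /colour_functionsP[uF u0] := uC; have /colour_functionsP[vF v0] := vC.
have fF : u - v \in face_functions 2 by have [_] := face_closed 2; apply.
pose f := u - v; pose a c := corner_diff black u c.
have fa c : f (c, 0) - f (c, 2) = a c /\ f (c, 1) - f (c, 3) = a c.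
  have [e1 e2 e3] := black_slots blackT c.
  have := uv c; rewrite /a /f !sub_ffunE !ffunE /=; case e0: (black (c, 0)) => /= e.
    rewrite (v0 (c, 0)) ?(v0 (c, 2)) ?(u0 (c, 1)) ?(u0 (c, 3)) /= ?e1 ?e2 ?e3 ?e0 //.
    by rewrite !subr0 !sub0r -opprD (oppF2 (_ - _)) e.
  rewrite (u0 (c, 0)) ?(u0 (c, 2)) ?(v0 (c, 1)) ?(v0 (c, 3)) /= ?e1 ?e2 ?e3 ?e0 //.
  by rewrite !subr0 !sub0r -opprD (oppF2 (_ - _)) e.
have f2 c : f (c, 2) = f (c, 0) + a c by have [<- _] := fa c; rewrite -(oppF2 (_ - _)) opprB addrC subrK.
have f3 c : f (c, 3) = f (c, 1) + a c by have [_ <-] := fa c; rewrite -(oppF2 (_ - _)) opprB addrC subrK.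
have grad_across d : grad f (across d) = grad f d.
  case: d => c s; case: Z4_add1 => E0 E1 E2 E3.
  rewrite -turn_turn /grad /turn /=.
  elim/Z4_ind: s; rewrite ?(E0, E1, E2, E3) f2 f3.
  - by rewrite opprD addrACA subrr addr0.
  - by rewrite opprD [- a c]oppF2 addrA addrAC.
  - by rewrite opprD addrACA subrr addr0.
  - by rewrite opprD [- a c]oppF2 [RHS]addrA [RHS]addrAC.
have gc : forall d d', grad f d = grad f d'.
  by apply: (knot_const _ grad_across) => d; rewrite grad_glue // oppF2.
apply/ffunP => c; rewrite [RHS]ffunE -[LHS]/(a c).
case: Z4_add1 => E0 E1 _ _; have := gc (c, 1) (c, 0); rewrite /grad /turn /= E0 E1 f2.
by rewrite addrAC -[RHS]oppF2 opprB -[RHS]addr0 => /addrI.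
Qed.

(** Here A^4 and zeta = - A^-4 are square roots of -1, and zeta ^ (e a) for a in
    {0, 1} is a quadratic function on F_2 with polar form (-1) ^ (a b). *)
Lemma bracket_neq0_fourth (L : fieldType) (A : L) :
  A ^+ 8 = -1 -> 2%:R != 0 :> L -> kauffman_bracket D A != 0.
Proof.
move=> A8 two_neq0; have [black [blackT blackG]] := checkerboard.
have A_neq0 : A != 0.
  by apply/eqP => A0; move/eqP: A8; rewrite A0 !expr0n /= eq_sym oppr_eq0 oner_eq0.
pose zeta : L := - A ^- 4.
have zeta2 : zeta ^+ 2 = -1.
  rewrite /zeta sqrrN -exprVn -exprM exprVn A8 invrN invr1 //.
have zeta4 : zeta ^+ 4 = 1 by rewrite (exprM zeta 2 2) zeta2 sqrrN expr1n.
have zexp m n : m = n %[mod 4] -> zeta ^+ m = zeta ^+ n.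
  by move=> mn; rewrite -(expr_mod m zeta4) mn expr_mod.
have zetaV : zeta^-1 = zeta ^+ 3.
  have zu : zeta != 0 by rewrite oppr_eq0 invr_eq0 expf_neq0.
  by apply: (mulfI zu); rewrite divff // -exprS zeta4.
have delta2 : (- A ^+ 2 - A ^- 2) ^+ 2 = 2%:R.
  have -> : (- A ^+ 2 - A ^- 2) ^+ 2 = 2%:R + A ^- 4 * (A ^+ 8 + 1) by field.
  by rewrite A8 addNr mulr0 addr0.
have z_prim : 2.-primitive_root (zeta ^+ 2).
  apply: prime_root_prim => //; first by rewrite -exprM zeta4.
  by rewrite zeta2 -subr_eq0 -opprD oppr_eq0.
pose e c : nat := if black (c, 0) then 1 else 3.
pose k (a : 'F_2) : nat := a != 0.
have wE c a : spin_weight A black c a = zeta ^+ (e c * k a).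
  rewrite /spin_weight -/zeta /e /k zetaV.
  by case: (a == 0); rewrite ?muln0 //; case: (black _); rewrite muln1.
have chiE (a : 'F_2) : chi (zeta ^+ 2) a = zeta ^+ (2 * a) by rewrite /chi exprM.
have wD c (a b : 'F_2) : spin_weight A black c (a + b)
    = spin_weight A black c a * spin_weight A black c b * chi (zeta ^+ 2) (1 * a * b).
  rewrite !wE chiE -!exprD /e; apply: zexp.
  by case: (black _); case: a => [[|[|//]] ?]; case: b => [[|[|//]] ?].
apply: (@bracket_neq0_of_quadratic 2) wD _ => // u /radical_F2 -> //.
by apply: big1 => c _; rewrite ffunE /spin_weight eqxx.
Qed.

(** * The value at 1 *)
Section Alternation.

Let step d : dart D := across (glue d).

Let step_inj : injective step.
Proof. exact: inj_comp (inv_inj (@acrossK D)) (inv_inj glueK). Qed.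

Let outgoing_step d : outgoing (step d) = outgoing d.
Proof. by rewrite outgoing_across outgoing_glue negbK. Qed.

Lemma fconnect_step d d' : outgoing d -> outgoing d' -> fconnect step d d'.
Proof.
move=> od od'.
(* Testing an incoming dart through its continuation makes P invariant along
   the whole knot. *)
pose P x := fconnect step d (if outgoing x then x else across x).
have P_across x : P (across x) = P x.
  by rewrite /P outgoing_across; case: (outgoing x); rewrite /= ?acrossK.
suff : P d' by rewrite /P od'.
rewrite (knot_const (f := P) _ P_across d' d) /P ?od ?connect0 // => x.
rewrite outgoing_glue; case: (boolP (outgoing x)) => ox /=.
  exact/esym/same_fconnect1_r.
by rewrite -[across x]/(across x) -{2}[x]glueK; apply/same_fconnect1_r.
Qed.

(** Following the knot from an outgoing dart runs through all 2 n outgoing darts. *)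
Lemma order_step d : outgoing d -> fingraph.order step d = (2 * #|D|)%N.
Proof.
move=> od; rewrite -card_dart_outgoing /fingraph.order.
suff E : fconnect step d =i [set x : dart D | outgoing x] by rewrite (eq_card E).
move=> d'; rewrite [RHS]inE unfold_in; apply/idP/idP => [/iter_findex <-|]; last exact: fconnect_step.
by elim: (findex _ _ _) => //= n IHn; rewrite outgoing_step.
Qed.

Definition alternating (h : {ffun dart D -> bool}) :=
  [forall d, (h (glue d) == h d) && (h (across d) == ~~ h d)].

(** Number the edges along the knot and take parities: the numbering closes up
    because the number 2 n of edges is even. *)
Lemma alternating_exists : exists h, alternating h.
Proof.
have [b ob] : exists b : dart D, outgoing b.
  have [od|od] := boolP (outgoing d0); first by exists d0.
  by exists (across d0); rewrite outgoing_across.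
pose k d := odd (findex step b d).
have kS d : outgoing d -> k (step d) = ~~ k d.
  move=> od; rewrite /k; have bd := fconnect_step ob od.
  have := findex_max bd; rewrite -{2}(iter_findex bd) -iterS.
  rewrite leq_eqVlt => /orP[/eqP E|lt_i]; last by rewrite findex_iter.
  have : ~~ odd (findex step b d).+1 by rewrite E order_step // mul2n odd_double.
  by rewrite oddS negbK => oi; rewrite E iter_order // findex0 oi.
exists [ffun d => if outgoing d then k d else ~~ k (across d)].
apply/forallP => d; rewrite !ffunE outgoing_glue outgoing_across acrossK.
case: (boolP (outgoing d)) => od /=; rewrite ?negbK eqxx andbT.
  by rewrite kS // negbK.
have -> : across d = step (glue d) by rewrite /step glueK.
by rewrite kS ?outgoing_glue // negbK.
Qed.

(** The two smoothings of a crossing, weighted 1 and -1, for a given colouring h of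
    the four edges around it.  The two terms cancel when all four colours agree. *)
Definition corner_sign (h : {ffun dart D -> bool}) c : int :=
  ((h (c, 0) == h (c, 1)) && (h (c, 2) == h (c, 3)))%:R
  - ((h (c, 1) == h (c, 2)) && (h (c, 3) == h (c, 0)))%:R.

Lemma signed_curve_sum :
  \sum_(S : {set D}) (\prod_c (-1) ^+ (c \notin S)) * 2 ^+ (curves (smoothing S)) 
  = \sum_(h : {ffun dart D -> bool} | [forall d, h (glue d) == h d])
       \prod_c corner_sign h c.
Proof.
transitivity (\sum_(S : {set D}) \sum_(h : {ffun dart D -> bool} | [forall d, h (glue d) == h d])
    \prod_c (if c \in S then ((h (c, 0) == h (c, 1)) && (h (c, 2) == h (c, 3)))%:R
             else - ((h (c, 1) == h (c, 2)) && (h (c, 3) == h (c, 0)))%:R) : int).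
  apply: eq_bigr => S _.
  have := card_curve_functions bool (smoothing_inv S) knot_circles.
  rewrite card_bool => /(congr1 (fun n => n%:R : int)); rewrite natrX => <-.
  rewrite -sum1_card natr_sum mulr_sumr.
  rewrite (eq_bigl (fun h : {ffun dart D -> bool} => [forall d, h (glue d) == h d] &&
    [forall d, h (d.1, smoothing S d.1 d.2) == h d])); last first.
    move=> h; rewrite inE; apply/forallP/andP => [hP|[/forallP h1 /forallP h2] d].
      by split; apply/forallP => d; have /andP[] := hP d.
    by rewrite h1 h2.
  rewrite big_mkcondr; apply: eq_bigr => h _; rewrite mulr1.
  pose X c := if c \in S then (h (c, 0) == h (c, 1)) && (h (c, 2) == h (c, 3))
              else (h (c, 1) == h (c, 2)) && (h (c, 3) == h (c, 0)).
  have XP c : reflect (forall s, h (c, smoothing S c s) = h (c, s)) (X c).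
    apply: (iffP idP) => [Xc|/smoothing_const].
      apply/smoothing_const; move: Xc; rewrite /X.
      by case: (c \in S) => /andP[/eqP-> /eqP->].
    by rewrite /X; case: (c \in S) => -[-> ->]; rewrite !eqxx.
  have -> : [forall d, h (d.1, smoothing S d.1 d.2) == h d] = [forall c, X c].
    apply/forallP/forallP => [hP c|hP [c s]]; last by apply/eqP; apply: (XP c (hP c)).
    by apply/XP => s; apply/eqP/(hP (c, s)).
  case: ifP => [/forallP hX|/negbT].
    apply: eq_bigr => c _; have := hX c; rewrite /X.
    by case: (c \in S) => ->; rewrite ?expr0 ?expr1.
  rewrite negb_forall => /existsP[c]; rewrite /X => nX.
  rewrite (bigD1 c) //=; case: (c \in S) nX => /negPf ->; by rewrite ?oppr0 mul0r.
rewrite exchange_big; apply: eq_bigr => h _.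
by rewrite -bigA_distr.
Qed.

Lemma corner_sign_eq0 (h : {ffun dart D -> bool}) : [forall d, h (glue d) == h d] ->
  (forall c, corner_sign h c != 0) -> alternating h.
Proof.
move=> /forallP hg hc; apply/forallP => d; rewrite hg /=; apply/eqP.
case: d => {}c s; have := hc c; rewrite /corner_sign /across /=.
case: Z4_add2 => E0 E1 E2 E3.
elim/Z4_ind: s; rewrite ?E0 ?E1 ?E2 ?E3;
by case: (h (c, 0)); case: (h (c, 1)); case: (h (c, 2)); case: (h (c, 3)).
Qed.

Lemma alternating_corner_sign (h : {ffun dart D -> bool}) c : alternating h -> `|corner_sign h c| = 1.
Proof.
move=> /forallP hP; rewrite /corner_sign.
have /andP[_ /eqP h2] := hP (c, 0); have /andP[_ /eqP h3] := hP (c, 1).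
move: h2 h3; rewrite /across /=; case: Z4_add2 => -> -> _ _ -> ->.
by case: (h (c, 0)); case: (h (c, 1)).
Qed.

(** Only the two alternating colourings contribute to [signed_curve_sum], and the
    complement of a colouring has the same sign, so the factor 2 cancels over
    the integers before anything is reduced modulo p. *)
Lemma signed_curve_sum_unit :
  `|\sum_(S : {set D}) (\prod_c (-1) ^+ (c \notin S)) * 2 ^+ (curves (smoothing S)).-1| = 1 :> int.
Proof.
have [h1 h1P] := alternating_exists.
pose h2 : {ffun dart D -> bool} := [ffun d => ~~ h1 d].
have h12 : h1 != h2 by apply/eqP => /ffunP/(_ d0); rewrite ffunE; case: (h1 d0).
have h2P : alternating h2.
  apply/forallP => d; rewrite !ffunE; have /andP[/eqP-> /eqP->] := forallP h1P d.
  by rewrite !eqxx.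
have altE h : alternating h = (h \in [set h1; h2]).
  rewrite !inE; apply/idP/orP => [hP|[/eqP->|/eqP->] //].
  have C d : h d (+) h1 d = h d0 (+) h1 d0.
    apply: (knot_const (f := fun d => h d (+) h1 d)) => {}d;
      have /andP[/eqP hg /eqP ha] := forallP hP d;
      have /andP[/eqP hg1 /eqP ha1] := forallP h1P d.
      by rewrite hg hg1.
    by rewrite ha ha1; case: (h d); case: (h1 d).
  case: (h d0 (+) h1 d0) C => C; [right|left]; apply/eqP/ffunP => d; rewrite ?ffunE;
    by have := C d; case: (h d); case: (h1 d).
have sumE : \sum_(h : {ffun dart D -> bool} | [forall d, h (glue d) == h d])
    \prod_c corner_sign h c = 2 * \prod_c corner_sign h1 c.
  rewrite (bigID alternating) /= [X in _ + X]big1 ?addr0 => [|h /andP[hg nalt]].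
    rewrite (eq_bigl (mem [set h1; h2])) => [|h].
      rewrite big_setU1 ?inE //= big_set1 -[X in _ = X * _]/(1 + 1) mulrDl mul1r.
      congr (_ + _); apply: eq_bigr => c _; rewrite /corner_sign !ffunE.
      by case: (h1 (c, 0)); case: (h1 (c, 1)); case: (h1 (c, 2)); case: (h1 (c, 3)).
    transitivity (h \in [set h1; h2]) => //; rewrite -altE andbC; case hP: (alternating h) => //=.
    by apply/forallP => d; have /andP[] := forallP hP d.
  apply/eqP; apply: contraNT nalt => /prodf_neq0 nz.
  by apply: corner_sign_eq0 => // c; apply: nz.
have two_neq0 : 2 != 0 :> int by [].
have : 2 * (\sum_(S : {set D}) (\prod_c (-1) ^+ (c \notin S)) * 2 ^+ (curves (smoothing S)).-1)
    = 2 * \prod_c corner_sign h1 c.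
  rewrite -sumE -signed_curve_sum mulr_sumr; apply: eq_bigr => S _.
  by rewrite mulrCA -exprS prednK // curves_gt0 //; apply: smoothing_inv.
move/(mulfI two_neq0) => ->; rewrite normr_prod big1 // => c _.
exact: alternating_corner_sign.
Qed.

(** Here delta = 2 and A^-1 = - A, so the bracket is A ^ n times the integer of
    [signed_curve_sum_unit]; this remains a unit in characteristic 2. *)
Lemma bracket_neq0_first (L : fieldType) (A : L) : A ^+ 2 = -1 -> kauffman_bracket D A != 0.
Proof.
move=> A2.
have A_neq0 : A != 0.
  by apply/eqP => A0; move/eqP: A2; rewrite A0 !expr0n /= eq_sym oppr_eq0 oner_eq0.
have AV : A^-1 = - A.
  by apply: (mulfI A_neq0); rewrite divff // mulrN -expr2 A2 opprK.
have -> : kauffman_bracket D A = A ^+ #|D| *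
   (\sum_(S : {set D}) (\prod_c (-1) ^+ (c \notin S)) * 2 ^+ (curves (smoothing S)).-1)%:~R.
  rewrite /kauffman_bracket rmorph_sum mulr_sumr /=; apply: eq_bigr => S _.
  rewrite rmorphM rmorph_prod /= mulrA; congr (_ * _); last first.
    rewrite rmorphXn /=; congr (_ ^+ _).
    by rewrite A2 invrN invr1 !opprK.
  rewrite state_weight // -prodr_const -big_split /=; apply: eq_bigr => c _.
  by rewrite AV; case: (c \in S); rewrite ?expr0 ?expr1 ?rmorph1 ?rmorphN1 ?mulr1 ?mulrN1.
rewrite mulf_neq0 ?expf_neq0 //.
have := signed_curve_sum_unit; set x := \sum_S _ => x1.
have : x ^+ 2 = 1 by rewrite -real_normK ?num_real // x1 expr1n.
move=> /eqP; rewrite sqrf_eq1 => /orP[] /eqP ->; first exact: oner_neq0.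
by rewrite rmorphN /= oppr_eq0 oner_neq0.
Qed.

End Alternation.
End Knot.
End Oriented.

(** * The value at primitive cube roots of unity *)

(** When A is itself a primitive cube root of unity, delta = 1 and
    A + A^-1 = -1. *)
Lemma bracket_neq0_third (D : diagram) (L : fieldType) (A : L) :
  A ^+ 2 + A + 1 = 0 -> kauffman_bracket D A != 0.
Proof.
move=> A2.
have A_neq0 : A != 0.
  by apply/eqP => A0; move/eqP: A2; rewrite A0 expr0n /= !add0r oner_eq0.
have AV : A^-1 = A ^+ 2.
  apply: (mulfI A_neq0); rewrite divff // -exprS; apply/esym/eqP; rewrite -subr_eq0.
  have -> : A ^+ 3 - 1 = (A - 1) * (A ^+ 2 + A + 1) by ring.
  by rewrite A2 mulr0.
have delta1 : - A ^+ 2 - A ^- 2 = 1.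
  rewrite -exprVn AV -exprM; apply/eqP; rewrite -subr_eq0.
  have -> : - A ^+ 2 - A ^+ (2 * 2) - 1 = - (A ^+ 2 + A + 1) * (A ^+ 2 - A + 1) by ring.
  by rewrite A2 oppr0 mul0r.
have -> : kauffman_bracket D A = (-1) ^+ #|D|.
  transitivity (\sum_(S : {set D}) \prod_c (if c \in S then A else A^-1)).
    by apply: eq_bigr => S _; rewrite delta1 expr1n mulr1 state_weight.
  rewrite -bigA_distr prodr_const; congr (_ ^+ _).
  by rewrite AV; apply/eqP; rewrite -subr_eq0 opprK addrC addrA -A2; apply/eqP; ring.
by rewrite signr_eq0.
Qed.

Lemma bracket_no_crossing (D : diagram) (L : comUnitRingType) (A : L) :
  (dart D -> False) -> components D = 1%N -> kauffman_bracket D A = 1.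
Proof.
move=> noD c1.
have noC (c : D) : False by apply: noD; exact: (c, 0).
have n0 (e : rel (dart D)) : n_comp e predT = 0%N.
  by rewrite /n_comp_mem; apply: eq_card0 => d; case: (noD d).
have curvesE (link : D -> 'Z_4 -> 'Z_4) : curves link = 1%N.
  by move: c1; rewrite /components /curves !n0.
rewrite /kauffman_bracket (eq_bigr (fun=> 1)) => [|S _].
  rewrite (eq_bigl (pred1 set0)) ?big_pred1_eq // => S /=.
  by apply/esym/eqP/setP => c; case: (noC c).
by rewrite curvesE expr0 mulr1 !eq_card0 // => c; case: (noC c).
Qed.

(** * Specializing Laurent polynomials *)

(** The Jones polynomial with A in an arbitrary field. *)
Definition jones_value (K : knot_diagram) (L : fieldType) (A : L) : L :=
  (- A ^+ 3) ^ (- writhe K) * kauffman_bracket K A.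

Lemma jones_value_neq0 (K : knot_diagram) (L : fieldType) (A : L) :
    [\/ A ^+ 2 = -1, A ^+ 2 + A + 1 = 0, A ^+ 8 = -1 /\ 2%:R != 0 :> L
      | A ^+ 8 - A ^+ 4 + 1 = 0 /\ 3%:R != 0 :> L] ->
  jones_value K A != 0.
Proof.
move=> hA.
have A_neq0 : A != 0.
  apply/eqP => A0; move: hA; rewrite A0 !expr0n /= subrr !add0r.
  by case=> [/eqP|/eqP|[/eqP]|[/eqP]]; rewrite ?oner_eq0 // eq_sym oppr_eq0 oner_eq0.
rewrite mulf_neq0 ?expfz_neq0 ?oppr_eq0 ?expf_neq0 //.
case: (pickP (predT : pred (dart K))) => [d0 _|noD]; last first.
  rewrite bracket_no_crossing ?oner_neq0 //; last exact: knot_connected.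
  by move=> d; have := noD d.
have Kor := @knot_oriented K; have K1 := @knot_connected K; have Kpl := @knot_planar K.
case: hA => [A2|A2|[A8 nz]|[A8 nz]].
- exact: (bracket_neq0_first Kor K1 d0).
- exact: bracket_neq0_third.
- exact: (bracket_neq0_fourth Kor K1 d0 Kpl).
- exact: (bracket_neq0_sixth Kor K1 d0 Kpl).
Qed.

Section Specialization.
Variables (L : fieldType) (a : L).
Hypothesis a_neq0 : a != 0.

(** The ring morphism from Z[t^(1/4), t^(-1/4)] to L that sends t^(1/4) to a, given
    by its graph inside the field of fractions, since it is not defined on the
    whole field. *)
Definition specializes (x : quarter_field) (y : L) : Prop :=
  exists (P : {poly int}) (m : nat),
    x * t4 ^+ m = tofrac P /\ y * a ^+ m = (map_poly intr P).[a].

Lemma specializes_tofrac (P : {poly int}) : specializes (tofrac P) (map_poly intr P).[a].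
Proof. by exists P, 0%N; rewrite !expr0 !mulr1. Qed.

Lemma t4_neq0 : t4 != 0.
Proof. by rewrite tofrac_eq0 polyX_eq0. Qed.

Lemma specializes_int (n : int) : specializes n%:~R n%:~R.
Proof.
have := specializes_tofrac n%:~R; rewrite !rmorph_int.
by rewrite -[in X in specializes _ X](rmorph_int (@polyC L)) hornerC.
Qed.

Lemma specializes_t4 : specializes t4 a.
Proof. by have := specializes_tofrac 'X; rewrite map_polyX hornerX. Qed.

Lemma specializes_t4V : specializes t4^-1 a^-1.
Proof.
exists 1, 1%N; rewrite !expr1 !mulVf ?t4_neq0 // !rmorph1 /=; split=> //.
by rewrite hornerC.
Qed.

Lemma specializesD x x' y y' :
  specializes x y -> specializes x' y' -> specializes (x + x') (y + y').
Proof.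
move=> [P [m [xP yP]]] [P' [m' [xP' yP']]].
exists (P * 'X^m' + P' * 'X^m), (m + m')%N; split.
  rewrite rmorphD !rmorphM /= !rmorphXn /= -/t4 -xP -xP' mulrDl exprD mulrA.
  by congr (_ + _); rewrite [t4 ^+ m * _]mulrC mulrA.
rewrite rmorphD !rmorphM /= !map_polyXn hornerD !hornerM !hornerXn -yP -yP' exprD.
by ring.
Qed.

Lemma specializesM x x' y y' :
  specializes x y -> specializes x' y' -> specializes (x * x') (y * y').
Proof.
move=> [P [m [xP yP]]] [P' [m' [xP' yP']]].
exists (P * P'), (m + m')%N; split; first by rewrite rmorphM /= -xP -xP' exprD mulrACA.
by rewrite rmorphM /= hornerM -yP -yP' exprD mulrACA.
Qed.

Lemma specializesX x y n : specializes x y -> specializes (x ^+ n) (y ^+ n).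
Proof.
move=> xy; elim: n => [|n IHn]; first exact: (specializes_int 1).
by rewrite !exprS; apply: specializesM.
Qed.

Lemma specializesN x y : specializes x y -> specializes (- x) (- y).
Proof.
by move=> xy; rewrite -mulN1r -[- y]mulN1r; apply: specializesM xy; exact: (specializes_int (-1)).
Qed.

Lemma specializes_exprz x y z : specializes x y -> specializes x^-1 y^-1 ->
  specializes (x ^ z) (y ^ z).
Proof.
by move=> xy xyV; case: z => n; rewrite /exprz -?exprVn; apply: specializesX.
Qed.

Lemma specializes_sum (I : finType) (F : I -> quarter_field) (G : I -> L) :
  (forall i, specializes (F i) (G i)) -> specializes (\sum_i F i) (\sum_i G i).
Proof.
move=> FG; elim/big_ind2: _ => //; first exact: (specializes_int 0).
move=> x y x' y'; exact: specializesD.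
Qed.

Lemma specializes_at_t P : specializes (at_t P) (map_poly intr P).[a ^+ 4].
Proof.
rewrite /at_t; elim/poly_ind: P => [|P c IHP].
  by rewrite !rmorph0 !horner0; exact: (specializes_int 0).
rewrite !rmorphD !rmorphM /= !map_polyX !map_polyC /= !hornerMXaddC.
apply: specializesD (specializes_int c); apply: specializesM => //.
exact/specializesX/specializes_t4.
Qed.

Lemma specializes_jones K : specializes (jones K) (jones_value K a^-1).
Proof.
have t4V : specializes t4^-1 a^-1 := specializes_t4V.
have t4VV : specializes t4^-1^-1 a^-1^-1 by rewrite !invrK; exact: specializes_t4.
apply: specializesM.
  apply: specializes_exprz; first exact/specializesN/specializesX.
  by rewrite !invrN -!exprVn; apply/specializesN/specializesX.
apply: specializes_sum => S; apply: specializesM; first exact: specializes_exprz.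
apply: specializesX; apply: specializesD; first exact/specializesN/specializesX.
by rewrite -!exprVn; apply/specializesN/specializesX.
Qed.

Lemma specializes_uniq x y y' : specializes x y -> specializes x y' -> y = y'.
Proof.
move=> [P [m [xP yP]]] [P' [m' [xP' yP']]].
have /(congr1 (fun Q : {poly int} => (map_poly intr Q).[a])) : P * 'X^m' = P' * 'X^m.
  by apply/eqP; rewrite -tofrac_eq !rmorphM /= !rmorphXn /= -xP -xP' -/t4 mulrAC eqxx.
rewrite /= !rmorphM /= !map_polyXn !hornerM !hornerXn -yP -yP'.
rewrite mulrAC => /(mulIf (expf_neq0 _ a_neq0)).
exact/mulIf/expf_neq0.
Qed.

Lemma not_laurent_dvd_of_value (P : {poly int}) (K : knot_diagram) :
  (map_poly intr P).[a ^+ 4] = 0 -> jones_value K a^-1 != 0 ->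
  ~ laurent_dvd (at_t P) (jones K).
Proof.
move=> P0 /eqP J0 [h [Q [m hE]] JE]; apply: J0.
apply: (specializes_uniq (specializes_jones K)); rewrite JE hE.
rewrite -[0](mulr0 ((map_poly intr Q).[a ^+ 4] * (a ^+ 4) ^- m)) -P0.
apply: specializesM (specializes_at_t P); apply: specializesM (specializes_at_t Q) _.
rewrite /tvar -!exprVn; exact/specializesX/specializesX/specializes_t4V.
Qed.

End Specialization.

(** * Roots of cyclotomic polynomials in characteristic p *)
Section CyclotomicRoots.
Variables (p : nat) (L : fieldType).
Hypothesis p_pchar : p \in [pchar L].

Let p_pr : prime p := pcharf_prime p_pchar.
Let Phi (n : nat) : {poly L} := map_poly intr 'Phi_n.

Lemma prod_Phi n : (0 < n)%N -> \prod_(d <- divisors n) Phi d = 'X^n - 1.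
Proof.
move=> n_gt0; rewrite -rmorph_prod /= prod_Cyclotomic //.
by rewrite rmorphB /= map_polyXn rmorph1.
Qed.

Lemma Phi_root_expr n t : (0 < n)%N -> (Phi n).[t] = 0 -> t ^+ n = 1.
Proof.
move=> n_gt0 P0; have := congr1 (horner^~ t) (prod_Phi n_gt0).
rewrite horner_prod (big_rem n) ?divisors_id //= P0 mul0r !hornerE => /esym/eqP.
by rewrite subr_eq0 => /eqP.
Qed.

(** The factors Phi_d with d | n p and not d | n multiply to
    (X^(n p) - 1) / (X^n - 1) = 1 + X^n + ... + X^(n (p - 1)), whose value at t
    is p = 0. *)
Lemma Phi_root_quotient n t : (0 < n)%N -> t ^+ n = 1 ->
  exists2 d, (d %| n * p)%N && ~~ (d %| n)%N & (Phi d).[t] = 0.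
Proof.
move=> n_gt0 tn; have np_gt0 : (0 < n * p)%N by rewrite muln_gt0 n_gt0 prime_gt0.
have E : \prod_(d <- divisors (n * p) | ~~ (d %| n)%N) Phi d = \sum_(i < p) 'X^n ^+ i.
  have nz : 'X^n - 1 != 0 :> {poly L} by apply/monic_neq0/monicXnsubC.
  apply: (mulfI nz); rewrite -subrX1 -exprM -prod_Phi // -(prod_Phi np_gt0).
  rewrite [RHS](bigID (fun d => d %| n)%N) /=; congr (_ * _).
  rewrite -[RHS]big_filter; apply: perm_big; apply: uniq_perm => [||d].
  - exact: divisors_uniq.
  - exact/filter_uniq/divisors_uniq.
  rewrite mem_filter -!dvdn_divisors //; case: (boolP (d %| n)%N) => //= dn.
  by rewrite dvdn_mulr.
have := congr1 (horner^~ t) E; rewrite horner_prod horner_sum.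
rewrite [RHS](eq_bigr (fun=> 1)) => [|i _]; last by rewrite !hornerE tn expr1n.
rewrite sumr_const card_ord (pcharf0 p_pchar) => /eqP.
rewrite prodf_seq_eq0 => /hasP[d]; rewrite -dvdn_divisors // => dnp /andP[dn /eqP P0].
by exists d; rewrite ?dnp.
Qed.

(** For k > 0 some Phi_d vanishes at t, where d | m p^k does not divide
    m p^(k-1); hence d = d' p^k with d' | m.  As t^d = 1 and the Frobenius map is
    injective, t^d' = 1, so that d' = m. *)
Lemma Phi_root_pchar m k t : (0 < m)%N -> ~~ (p %| m)%N -> t ^+ m = 1 ->
    (forall d, (d %| m)%N -> t ^+ d = 1 -> d = m) ->
  (Phi (m * p ^ k)).[t] = 0.
Proof.
move=> m_gt0 pm tm t_ord.
case: k => [|k].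
  rewrite expn0 muln1; have := congr1 (horner^~ t) (prod_Phi m_gt0).
  rewrite horner_prod !hornerE tm subrr => /eqP.
  rewrite prodf_seq_eq0 => /hasP[d]; rewrite -dvdn_divisors // => dm /eqP P0.
  by rewrite -(t_ord d dm) // (Phi_root_expr _ P0) // (dvdn_gt0 m_gt0).
have mk_gt0 : (0 < m * p ^ k)%N by rewrite muln_gt0 m_gt0 expn_gt0 prime_gt0.
have tmk : t ^+ (m * p ^ k) = 1 by rewrite exprM tm expr1n.
have [d /andP[]] := Phi_root_quotient mk_gt0 tmk.
rewrite -mulnA -expnSr => d_dv d_ndv P0.
have d_gt0 : (0 < d)%N by rewrite (dvdn_gt0 _ d_dv) // muln_gt0 m_gt0 expn_gt0 prime_gt0.
have [d' pd' dE] := pfactor_coprime p_pr d_gt0.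
have d'm : (d' %| m)%N.
  rewrite -(@Gauss_dvdl _ _ (p ^ k.+1)); last by rewrite coprime_sym coprimeXl.
  by apply: dvdn_trans d_dv; rewrite [X in dvdn _ X]dE dvdn_mulr.
have jE : logn p d = k.+1.
  apply/eqP; rewrite eqn_leq; apply/andP; split.
    have N_gt0 : (0 < m * p ^ k.+1)%N by rewrite muln_gt0 m_gt0 expn_gt0 prime_gt0.
    have := dvdn_leq_log p N_gt0 d_dv.
    by rewrite logn_Gauss ?prime_coprime // pfactorK.
  rewrite ltnNge; apply: contra d_ndv => jk.
  by rewrite dE dvdn_mul // dvdn_exp2l.
have td' : t ^+ d' = 1.
  have pnat : [pchar L].-nat (p ^ k.+1)%N.
    by rewrite (eq_pnat _ (pcharf_eq p_pchar)) pnatX pnat_id.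
  have := Phi_root_expr d_gt0 P0; rewrite dE jE exprM => td.
  apply/eqP; rewrite -subr_eq0.
  have : (t ^+ d' - 1) ^+ (p ^ k.+1) == 0 by rewrite exprDn_pchar // exprNn_pchar // td expr1n subrr.
  by rewrite expf_eq0 => /andP[].
by move: P0; rewrite dE jE (t_ord d' d'm td').
Qed.

End CyclotomicRoots.

(** * Non-divisibility *)
Lemma closed_field_of_pchar (p : nat) : prime p ->
  {L : closedFieldType | p \in [pchar L]}.
Proof.
move=> p_pr; have [L [f _]] := countable_algebraic_closure 'F_p.
exists L; rewrite (fmorph_pchar f); exact: pchar_Fp.
Qed.

Lemma not_laurent_dvd_at_root (p m k : nat) (L : closedFieldType) (A : L)
    (K : knot_diagram) :
    p \in [pchar L] -> (0 < m)%N -> ~~ (p %| m)%N -> A != 0 ->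
    (A ^- 4) ^+ m = 1 ->
    (forall d, (d %| m)%N -> (A ^- 4) ^+ d = 1 -> d = m) ->
    jones_value K A != 0 ->
  ~ laurent_dvd (at_t 'Phi_(m * p ^ k)) (jones K).
Proof.
move=> p_pchar m_gt0 pm A_neq0 tm t_ord JA.
apply: (@not_laurent_dvd_of_value L A^-1); rewrite ?invr_eq0 ?invrK //.
rewrite exprVn; exact: Phi_root_pchar.
Qed.

Lemma pchar_natr_neq0 (p q : nat) (L : fieldType) :
  p \in [pchar L] -> prime q -> p <> q -> q%:R != 0 :> L.
Proof.
move=> p_pchar q_pr pq; rewrite -(dvdn_pcharf p_pchar) dvdn_prime2 //.
  exact/eqP.
exact: pcharf_prime p_pchar.
Qed.

Section Cases.
Variables (p k : nat) (p_prime : prime p) (K : knot_diagram).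

Lemma Phi_prime_power_ndvd : ~ laurent_dvd (at_t 'Phi_(p ^ k)) (jones K).
Proof.
have [L p_pchar] := closed_field_of_pchar p_prime.
(* A root of X^2 + 1. *)
have [A] := @solve_monicpoly L 2 (fun i => - (i == 0%N)%:R) isT.
rewrite !big_ord_recl big_ord0 /= expr0 !mulr1 oppr0 mul0r !addr0 => A2.
have A_neq0 : A != 0.
  by apply/eqP => A0; move/eqP: A2; rewrite A0 expr0n /= eq_sym oppr_eq0 oner_eq0.
rewrite -[(p ^ k)%N]mul1n; apply: (@not_laurent_dvd_at_root p 1 k L A) => //.
- by rewrite dvdn1; case: (p) p_prime => [|[]].
- by rewrite expr1 (exprM A 2 2) A2 sqrrN expr1n invr1.
- by move=> d; rewrite dvdn1 => /eqP.
- by apply: jones_value_neq0; constructor 1.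
Qed.

Lemma Phi_3_ndvd : p <> 3%N -> ~ laurent_dvd (at_t 'Phi_(3 * p ^ k)) (jones K).
Proof.
move=> p3; have [L p_pchar] := closed_field_of_pchar p_prime.
have three_neq0 := pchar_natr_neq0 p_pchar (isT : prime 3) p3.
(* A root of X^2 + X + 1. *)
have [A] := @solve_monicpoly L 2 (fun i => -1) isT.
rewrite !big_ord_recl big_ord0 /= expr0 expr1 mulr1 mulN1r addr0 => A2.
have {}A2 : A ^+ 2 + A + 1 = 0 by rewrite A2; ring.
have A_neq0 : A != 0.
  by apply/eqP => A0; move/eqP: A2; rewrite A0 expr0n /= !add0r oner_eq0.
have A3 : A ^+ 3 = 1.
  apply/eqP; rewrite -subr_eq0.
  have -> : A ^+ 3 - 1 = (A - 1) * (A ^+ 2 + A + 1) by ring.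
  by rewrite A2 mulr0.
have A1 : A != 1.
  apply: contraNneq three_neq0 => A1; rewrite -A2 A1; apply/eqP; ring.
apply: (@not_laurent_dvd_at_root p 3 k L A) => //.
- by rewrite dvdn_prime2 //; apply/eqP.
- by rewrite exprVn -exprM (exprM A 3 4) A3 expr1n invr1.
- move=> d; rewrite exprS A3 mulr1.
  move=> /(prime_nt_dvdP (isT : prime 3)) H; case: (eqVneq d 1%N) => [->|d1 _].
    by rewrite expr1 => /eqP; rewrite invr_eq1 (negPf A1).
  exact: H.
- by apply: jones_value_neq0; constructor 2.
Qed.

Lemma Phi_4_ndvd : p <> 2%N -> ~ laurent_dvd (at_t 'Phi_(4 * p ^ k)) (jones K).
Proof.
move=> p2; have [L p_pchar] := closed_field_of_pchar p_prime.
have two_neq0 := pchar_natr_neq0 p_pchar (isT : prime 2) p2.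
(* A root of X^8 + 1, so that A^-4 is a square root of -1. *)
have [A] := @solve_monicpoly L 8 (fun i => - (i == 0%N)%:R) isT.
rewrite !big_ord_recl big_ord0 /= expr0 !mulr1 oppr0 !mul0r !addr0 => A8.
have A_neq0 : A != 0.
  by apply/eqP => A0; move/eqP: A8; rewrite A0 expr0n /= eq_sym oppr_eq0 oner_eq0.
have t2 : (A ^- 4) ^+ 2 = -1 by rewrite exprVn -exprM A8 invrN invr1.
have N1 : -1 != 1 :> L.
  by rewrite -subr_eq0 -opprD oppr_eq0.
apply: (@not_laurent_dvd_at_root p 4 k L A) => //.
- by rewrite (_ : 4 = 2 ^ 2)%N // Euclid_dvdX // andbT dvdn_prime2 //; apply/eqP.
- by rewrite (exprM _ 2 2) t2 sqrrN expr1n.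
- move=> d; have: (d <= 4)%N -> (d %| 4)%N -> [\/ d = 1, d = 2 | d = 4]%N.
    by case: d => [|[|[|[|[|//]]]]] // _ d4;
      first [by constructor 1 | by constructor 2 | by constructor 3 | by move: d4].
  move=> H d4; have [->|->|->] := H (dvdn_leq (isT : 0 < 4)%N d4) d4 => //.
    move=> t1; move: t2; rewrite -[2%N]/(1 + 1)%N exprD t1 mulr1 => /esym/eqP.
    by rewrite (negPf N1).
  by rewrite t2 => /eqP; rewrite (negPf N1).
- by apply: jones_value_neq0; constructor 3.
Qed.

Lemma Phi_6_ndvd : p <> 2%N -> p <> 3%N ->
  ~ laurent_dvd (at_t 'Phi_(6 * p ^ k)) (jones K).
Proof.
move=> p2 p3; have [L p_pchar] := closed_field_of_pchar p_prime.
have two_neq0 := pchar_natr_neq0 p_pchar (isT : prime 2) p2.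
have three_neq0 := pchar_natr_neq0 p_pchar (isT : prime 3) p3.
(* A root of X^8 - X^4 + 1, so that A^-4 is a primitive sixth root of unity. *)
have [A] := @solve_monicpoly L 8 (fun i => (i == 4)%:R - (i == 0%N)%:R) isT.
rewrite !big_ord_recl big_ord0 /= expr0 !mulr1 !subr0 !sub0r !mul0r !mul1r !addr0 !add0r.
rewrite /bump /= => A8.
have {}A8 : A ^+ 8 - A ^+ 4 + 1 = 0 by rewrite A8; ring.
have A_neq0 : A != 0.
  by apply/eqP => A0; move/eqP: A8; rewrite A0 !expr0n /= subrr add0r oner_eq0.
pose t := A ^- 4.
have t2 : t ^+ 2 - t + 1 = 0.
  by rewrite -[RHS](mulr0 (A ^- 8)) -A8 /t; field.
have t3 : t ^+ 3 = -1.
  apply/eqP; rewrite -subr_eq0 opprK.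
  have -> : t ^+ 3 + 1 = (t + 1) * (t ^+ 2 - t + 1) by ring.
  by rewrite t2 mulr0.
have N1 : -1 != 1 :> L by rewrite -subr_eq0 -opprD oppr_eq0.
apply: (@not_laurent_dvd_at_root p 6 k L A) => //; rewrite -?/t.
- by rewrite (_ : 6 = 2 * 3)%N // Euclid_dvdM // !dvdn_prime2 // negb_or;
    apply/andP; split; apply/eqP.
- by rewrite (exprM _ 3 2) t3 sqrrN expr1n.
- move=> d; have: (d <= 6)%N -> (d %| 6)%N -> [\/ d = 1, d = 2, d = 3 | d = 6]%N.
    by case: d => [|[|[|[|[|[|[|//]]]]]]] // _ d6;
      first [by constructor 1 | by constructor 2 | by constructor 3 | by constructor 4
            | by move: d6].
  move=> H d6; have [->|->|->|->] := H (dvdn_leq (isT : 0 < 6)%N d6) d6 => // /eqP td.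
  + by move: t3; rewrite -[t]expr1 (eqP td) expr1n => /esym/eqP; rewrite (negPf N1).
  + have t_eq2 : t = 2%:R.
      by apply/eqP; rewrite -subr_eq0 -oppr_eq0 -t2 (eqP td); apply/eqP; ring.
    have three_eq : 3%:R = t ^+ 2 - t + 1 by rewrite t_eq2; ring.
    by move: three_neq0; rewrite three_eq t2 eqxx.
  + by rewrite t3 (negPf N1) in td.
- by apply: jones_value_neq0; constructor 4.
Qed.

End Cases.

Theorem theorem4 (k p N : nat) (p_prime : prime p)
    (hN : [\/ N = (p ^ k)%N, N = (3 * p ^ k)%N, N = (4 * p ^ k)%N
            | N = (6 * p ^ k)%N /\ p <> 3%N])
    (K : knot_diagram) :
  ~ laurent_dvd (at_t ('Phi_N)) (jones K).
Proof.
case: hN => [->|->|->|[-> p3]]; first exact: Phi_prime_power_ndvd.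
- case: (eqVneq p 3%N) => [->|/eqP p3]; last exact: Phi_3_ndvd.
  by rewrite -expnS; apply: Phi_prime_power_ndvd.
- case: (eqVneq p 2%N) => [->|/eqP p2]; last exact: Phi_4_ndvd.
  by rewrite (_ : 4 = 2 ^ 2)%N // -expnD; apply: Phi_prime_power_ndvd.
case: (eqVneq p 2%N) => [->|/eqP p2]; last exact: Phi_6_ndvd.
by rewrite (_ : 6 = 3 * 2)%N // -mulnA -expnS; apply: Phi_3_ndvd.
Qed.
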